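(* Let $k\in\mathbb{Z}$. If $n_1<n_2$ or $k\neq 0$, the subspace $\mathcal{B}_{\langle k\rangle}$ is an irreducible $sp(2n,\mathbb{F})$-submodule. When $n_1=n_2$, the subspace $\mathcal{B}_{\langle 0\rangle}$ is a direct sum of two irreducible $sp(2n,\mathbb{F})$-submodules. Moreover, each of these irreducible submodules is of highest-weight type only if $n_2=n$. When $n_1=n_2=n$, all these irreducible submodules are of $(\mathcal{G},\mathcal{K})$-type, where $\mathcal{G}=sp(2n,\mathbb{F})$.
   Context: $\mathbb{F}$ is a field of characteristic $0$, $n\geq 2$ is an integer, and $n_1,n_2$ are fixed integers with $1\leq n_1\leq n_2\leq n$. $\mathbb{N}$ is the set of nonnegative integers, $\overline{i,j}=\{i,\dots,j\}$, $\delta$ is the Kronecker delta, and $E_{i,j}$ are matrix units. Let $\mathcal{B}=\mathbb{F}[x_1,\dots,x_n,y_1,\dots,y_n]$, $x^\alpha y^\beta=\prod_i x_i^{\alpha_i}y_i^{\beta_i}$. Define operators on $\mathcal{B}$, for $i,j\in\overline{1,n}$: - $E^x_{i,j}=-x_j\partial_{x_i}-\delta_{i,j}$ if $i,j\in\overline{1,n_1}$; $\ \partial_{x_i}\partial_{x_j}$ if $i\in\overline{1,n_1},\,j\in\overline{n_1+1,n}$; $\ -x_ix_j$ if $i\in\overline{n_1+1,n},\,j\in\overline{1,n_1}$; $\ x_i\partial_{x_j}$ if $i,j\in\overline{n_1+1,n}$. - $E^y_{i,j}=y_i\partial_{y_j}$ if $i,j\in\overline{1,n_2}$; $\ -y_iy_j$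 if $i\in\overline{1,n_2},\,j\in\overline{n_2+1,n}$; $\ \partial_{y_i}\partial_{y_j}$ if $i\in\overline{n_2+1,n},\,j\in\overline{1,n_2}$; $\ -y_j\partial_{y_i}-\delta_{i,j}$ if $i,j\in\overline{n_2+1,n}$. - $E_{i,n+j}|_{\mathcal{B}}=\partial_{x_i}\partial_{y_j}$ if $i\in\overline{1,n_1},\,j\in\overline{1,n_2}$; $\ -y_j\partial_{x_i}$ if $i\in\overline{1,n_1},\,j\in\overline{n_2+1,n}$; $\ x_i\partial_{y_j}$ if $i\in\overline{n_1+1,n},\,j\in\overline{1,n_2}$; $\ -x_iy_j$ if $i\in\overline{n_1+1,n},\,j\in\overline{n_2+1,n}$. - $E_{n+i,j}|_{\mathcal{B}}=-x_jy_i$ if $j\in\overline{1,n_1},\,i\in\overline{1,n_2}$; $\ -x_j\partial_{y_i}$ if $j\in\overline{1,n_1},\,i\in\overline{n_2+1,n}$; $\ y_i\partial_{x_j}$ if $j\in\overline{n_1+1,n},\,i\in\overline{1,n_2}$; $\ \partial_{x_j}\partial_{y_i}$ if $j\in\overline{n_1+1,n},\,i\in\overline{n_2+1,n}$. The symplectic Lie algebra is $$sp(2n,\mathbb{F})=\sum_{i,j=1}^n\mathbb{F}(E_{i,j}-E_{n+j,n+i})+\sum_{i=1}^n(\mathbb{F}E_{i,n+i}+\mathbb{F}E_{n+i,i})+\sum_{1\leq i<j\leq n}[\mathbb{F}(E_{i,n+j}+E_{j,n+i})+\mathbb{F}(E_{n+i,j}+E_{n+j,i})].$$ It acts on $\mathcal{B}$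 by $(E_{i,j}-E_{n+j,n+i})|_{\mathcal{B}}=E^x_{i,j}-E^y_{j,i}$ and, for the other basis elements, by the corresponding operators $E_{i,n+j}|_{\mathcal{B}}$, $E_{n+i,j}|_{\mathcal{B}}$ above and their sums. For $k\in\mathbb{Z}$, $\mathcal{B}_{\langle k\rangle}$ is the span of the monomials $x^\alpha y^\beta$ ($\alpha,\beta\in\mathbb{N}^n$) with $-\sum_{i=1}^{n_1}\alpha_i+\sum_{r=n_1+1}^n\alpha_r+\sum_{i=1}^{n_2}\beta_i-\sum_{r=n_2+1}^n\beta_r=k$. $\mathcal{K}=\sum_{i,j=1}^n\mathbb{F}(E_{i,j}-E_{n+j,n+i})$. An infinite-dimensional irreducible $\mathcal{G}$-module is of $(\mathcal{G},\mathcal{K})$-type if it is a direct sum of finite-dimensional irreducible $\mathcal{K}$-submodules. Highest-weight type is meant with respect to the Cartan subalgebra $\sum_i\mathbb{F}(E_{i,i}-E_{n+i,n+i})$ and the positive root vectors $E_{i,j}-E_{n+j,n+i}$, $E_{i,n+j}+E_{j,n+i}$ ($i<j$), $E_{i,n+i}$. *)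

(* Defs.v *)
From HB Require Import structures.
From mathcomp Require Import all_boot all_order all_algebra.
From mathcomp Require Export mpoly.

Set Implicit Arguments.
Unset Strict Implicit.
Unset Printing Implicit Defensive.

Import Order.TTheory GRing.Theory Num.Theory.
Local Open Scope ring_scope.

(* Subspaces of a possibly infinite-dimensional space V are predicates
   V -> Prop; subspaces of the finite-dimensional space of matrices are
   MathComp's {vspace _}. *)

Definition lin_span (F : fieldType) (V : lmodType F) (S : V -> Prop) : V -> Prop :=
  fun v => exists s : seq (F * V),
    (forall a, a \in s -> S a.2) /\ v = \sum_(a <- s) a.1 *: a.2.

Definition is_subspace (F : fieldType) (V : lmodType F) (W : V -> Prop) : Prop :=
  W 0 /\ forall (a : F) (u v : V), W u -> W v -> W (a *: u + v).

Definition fin_dim (F : fieldType) (V : lmodType F) (W : V -> Prop) : Prop :=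
  exists s : seq V, (forall v, v \in s -> W v) /\
    forall v, W v -> lin_span (fun u => u \in s) v.

Definition is_direct_sum (F : fieldType) (V : lmodType F) (I : eqType)
    (W : V -> Prop) (U : I -> V -> Prop) : Prop :=
  [/\ forall i v, U i v -> W v,
      forall v, W v -> exists (s : seq I) (u : I -> V),
        [/\ uniq s, forall i, U i (u i) & v = \sum_(i <- s) u i]
    & forall (s : seq I) (u : I -> V), uniq s -> (forall i, U i (u i)) ->
        \sum_(i <- s) u i = 0 -> forall i, i \in s -> u i = 0].

(* In the next two definitions L is the ambient space of a Lie algebra g,
   and rho gives the operator on V by which each element of g acts. *)

Definition is_submodule (F : fieldType) (L : vectType F) (V : lmodType F)
    (rho : L -> V -> V) (g : {vspace L}) (W : V -> Prop) : Prop :=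
  is_subspace W /\ forall A v, A \in g -> W v -> W (rho A v).

Definition irreducible_submodule (F : fieldType) (L : vectType F)
    (V : lmodType F) (rho : L -> V -> V) (g : {vspace L})
    (W : V -> Prop) : Prop :=
  [/\ is_submodule rho g W,
      exists2 v, W v & v <> 0
    & forall U : V -> Prop, is_submodule rho g U -> (forall v, U v -> W v) ->
        (forall v, U v -> v = 0) \/ (forall v, W v -> U v)].

(* Rows and columns 1..n (resp. n+1..2n) of a matrix of size
   n + n are indexed by lshift n i (resp. rshift n i), i : 'I_n. *)

Section Matrices.
Context (F : fieldType) (n : nat).
Implicit Types i j : 'I_n.

Definition gl_root i j : 'M[F]_(n + n) :=
  delta_mx (lshift n i) (lshift n j) - delta_mx (rshift n j) (rshift n i).

Definition E_up i j : 'M[F]_(n + n) := delta_mx (lshift n i) (rshift n j).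

Definition E_low i j : 'M[F]_(n + n) := delta_mx (rshift n i) (lshift n j).

Definition K_alg : {vspace 'M[F]_(n + n)} :=
  (\sum_(i < n) \sum_(j < n) <[gl_root i j]>)%VS.

Definition sp_alg : {vspace 'M[F]_(n + n)} :=
  (K_alg
   + \sum_(i < n) (<[E_up i i]> + <[E_low i i]>)
   + \sum_(i < n) \sum_(j < n | (i < j)%N)
       (<[E_up i j + E_up j i]> + <[E_low i j + E_low j i]>))%VS.

Definition cartan : {vspace 'M[F]_(n + n)} :=
  (\sum_(i < n) <[gl_root i i]>)%VS.

Definition pos_root_vector (A : 'M[F]_(n + n)) : Prop :=
  (exists i j, (i < j)%N /\ (A = gl_root i j \/ A = E_up i j + E_up j i))
  \/ (exists i, A = E_up i i).

End Matrices.

(* x_i and y_i are the variables of {mpoly F[n + n]}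
   of index lshift n i and rshift n i.  The first index in 'I_n is 0, so
   the condition i <= n1 on 1-based indices reads (i < n1)%N. *)

Section Operators.
Context (F : fieldType) (n n1 n2 : nat).
Implicit Types (i j : 'I_n) (f : {mpoly F[n + n]}).

Definition xvar i : {mpoly F[n + n]} := 'X_(lshift n i).
Definition yvar i : {mpoly F[n + n]} := 'X_(rshift n i).
Definition dX i f : {mpoly F[n + n]} := f^`M(lshift n i).
Definition dY i f : {mpoly F[n + n]} := f^`M(rshift n i).

Definition Ex i j f : {mpoly F[n + n]} :=
  match (i < n1)%N, (j < n1)%N with
  | true, true => - (xvar j * dX i f) - f *+ (i == j)
  | true, false => dX i (dX j f)
  | false, true => - (xvar i * xvar j * f)
  | false, false => xvar i * dX j f
  end.

Definition Ey i j f : {mpoly F[n + n]} :=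
  match (i < n2)%N, (j < n2)%N with
  | true, true => yvar i * dY j f
  | true, false => - (yvar i * yvar j * f)
  | false, true => dY i (dY j f)
  | false, false => - (yvar j * dY i f) - f *+ (i == j)
  end.

(* E_{i,n+j} restricted to polynomials *)
Definition Exy i j f : {mpoly F[n + n]} :=
  match (i < n1)%N, (j < n2)%N with
  | true, true => dX i (dY j f)
  | true, false => - (yvar j * dX i f)
  | false, true => xvar i * dY j f
  | false, false => - (xvar i * yvar j * f)
  end.

(* E_{n+i,j} restricted to polynomials *)
Definition Eyx i j f : {mpoly F[n + n]} :=
  match (j < n1)%N, (i < n2)%N with
  | true, true => - (xvar j * yvar i * f)
  | true, false => - (xvar j * dY i f)
  | false, true => yvar i * dX j f
  | false, false => dX j (dY i f)
  end.

(* Linear extension of the action from the basis of sp(2n): on sp(2n) the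
   coordinate of A on gl_root i j is its (i, j) entry, the coordinate on
   E_up i i, or on E_up i j + E_up j i with i < j, is its (i, n+j) entry, and
   likewise for E_low with the (n+i, j) entry.  The values on matrices outside
   sp(2n) are irrelevant. *)
Definition sp_act (A : 'M[F]_(n + n)) f : {mpoly F[n + n]} :=
  \sum_(i < n) \sum_(j < n)
     A (lshift n i) (lshift n j) *: (Ex i j f - Ey j i f)
  + \sum_(i < n) (A (lshift n i) (rshift n i) *: Exy i i f
                  + A (rshift n i) (lshift n i) *: Eyx i i f)
  + \sum_(i < n) \sum_(j < n | (i < j)%N)
     (A (lshift n i) (rshift n j) *: (Exy i j f + Exy j i f)
      + A (rshift n i) (lshift n j) *: (Eyx i j f + Eyx j i f)).

Definition grade (m : 'X_{1..n + n}) : int :=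
  - (\sum_(i < n | (i < n1)%N) (m (lshift n i))%:Z)
  + \sum_(r < n | (n1 <= r)%N) (m (lshift n r))%:Z
  + \sum_(i < n | (i < n2)%N) (m (rshift n i))%:Z
  - \sum_(r < n | (n2 <= r)%N) (m (rshift n r))%:Z.

Definition B_part (k : int) : {mpoly F[n + n]} -> Prop :=
  lin_span (fun f => exists2 m : 'X_{1..n + n}, grade m = k & f = 'X_[m]).

Definition sp_irreducible (W : {mpoly F[n + n]} -> Prop) : Prop :=
  irreducible_submodule sp_act (sp_alg F n) W.

Definition highest_weight_type (W : {mpoly F[n + n]} -> Prop) : Prop :=
  exists v : {mpoly F[n + n]},
    [/\ W v /\ v <> 0,
        exists lambda : {scalar 'M[F]_(n + n)},
          forall h, h \in cartan F n -> sp_act h v = lambda h *: v,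
        forall A, pos_root_vector A -> sp_act A v = 0
      & forall U, is_submodule sp_act (sp_alg F n) U -> U v ->
          forall f, W f -> U f].

Definition GK_type (W : {mpoly F[n + n]} -> Prop) : Prop :=
  [/\ ~ fin_dim W, sp_irreducible W
    & exists (I : eqType) (U : I -> {mpoly F[n + n]} -> Prop),
        is_direct_sum W U /\
        forall c, fin_dim (U c) /\
          irreducible_submodule sp_act (K_alg F n) (U c)].

End Operators.

Section Basis.
Context (F : fieldType) (n n1 n2 : nat).
Implicit Types (i j k l : 'I_n) (f : {mpoly F[n + n]}).

Let entries := (mxE, eq_lshift, eq_rshift, eq_lrshift, eq_rlshift, andbF,
  andFb, subr0, sub0r, addr0, add0r).

Lemma sum_delta (V : lmodType F) i j (G : 'I_n -> 'I_n -> V) :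
  \sum_(k < n) \sum_(l < n) ((k == i) && (l == j))%:R *: G k l = G i j.
Proof.
rewrite (bigD1 i) //= (bigD1 j) //= !eqxx scale1r !big1 ?addr0 //.
- by move=> k /negPf ki; rewrite big1 // => l _; rewrite ki scale0r.
- by move=> l /negPf lj; rewrite lj scale0r.
Qed.

Lemma sum_delta_diag (V : lmodType F) i (G : 'I_n -> V) :
  \sum_(k < n) ((k == i) && (k == i))%:R *: G k = G i.
Proof.
rewrite (bigD1 i) //= eqxx scale1r big1 ?addr0 //.
by move=> k /negPf ki; rewrite ki scale0r.
Qed.

Lemma sum_delta_lt (V : lmodType F) i j (G : 'I_n -> 'I_n -> V) :
  \sum_(k < n) \sum_(l < n | (k < l)%N) ((k == i) && (l == j))%:R *: G k l
  = if (i < j)%N then G i j else 0.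
Proof.
under eq_bigr do rewrite big_mkcond.
rewrite -(sum_delta i j (fun k l => if (k < l)%N then G k l else 0)).
by apply: eq_bigr => k _; apply: eq_bigr => l _; case: ifP; rewrite ?scaler0.
Qed.

Lemma sp_act_gl_root i j f :
  sp_act n1 n2 (gl_root F i j) f = Ex n1 i j f - Ey n2 j i f.
Proof.
rewrite /sp_act /gl_root.
rewrite [X in _ + X + _]big1 => [|k _]; last by rewrite !entries oppr0 !scale0r addr0.
rewrite [X in _ + X]big1 => [|k _]; last first.
  by rewrite big1 // => l _; rewrite !entries oppr0 !scale0r addr0.
rewrite !addr0 -[RHS](sum_delta i j (fun k l => Ex n1 k l f - Ey n2 l k f)).
by apply: eq_bigr => k _; apply: eq_bigr => l _; rewrite !entries.
Qed.

Lemma sp_act_E_up_diag i f : sp_act n1 n2 (E_up F i i) f = Exy n1 n2 i i f.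
Proof.
rewrite /sp_act /E_up.
rewrite big1 => [|k _]; last by rewrite big1 // => l _; rewrite !entries scale0r.
rewrite [X in _ + X + _](_ : _ = Exy n1 n2 i i f); last first.
  rewrite -[RHS](sum_delta_diag i (fun k => Exy n1 n2 k k f)).
  by apply: eq_bigr => k _; rewrite !entries scale0r addr0.
rewrite [X in _ + X](_ : _ = 0) ?addr0 ?add0r //.
have /= := sum_delta_lt i i (fun k l => Exy n1 n2 k l f + Exy n1 n2 l k f).
rewrite ltnn => sum0; rewrite -[RHS]sum0.
apply: eq_bigr => k _; apply: eq_bigr => l _.
by rewrite !entries scale0r addr0.
Qed.

Lemma sp_act_E_low_diag i f : sp_act n1 n2 (E_low F i i) f = Eyx n1 n2 i i f.
Proof.
rewrite /sp_act /E_low.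
rewrite big1 => [|k _]; last by rewrite big1 // => l _; rewrite !entries scale0r.
rewrite [X in _ + X + _](_ : _ = Eyx n1 n2 i i f); last first.
  rewrite -[RHS](sum_delta_diag i (fun k => Eyx n1 n2 k k f)).
  by apply: eq_bigr => k _; rewrite !entries scale0r add0r.
rewrite [X in _ + X](_ : _ = 0) ?addr0 ?add0r //.
have /= := sum_delta_lt i i (fun k l => Eyx n1 n2 k l f + Eyx n1 n2 l k f).
rewrite ltnn => sum0; rewrite -[RHS]sum0.
apply: eq_bigr => k _; apply: eq_bigr => l _.
by rewrite !entries scale0r add0r.
Qed.

Lemma sp_act_E_up i j f : (i < j)%N ->
  sp_act n1 n2 (E_up F i j + E_up F j i) f = Exy n1 n2 i j f + Exy n1 n2 j i f.
Proof.
move=> ij; have /negPf neq_ij : i != j by rewrite neq_ltn ij.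
rewrite /sp_act /E_up.
rewrite big1 => [|k _]; last by rewrite big1 // => l _; rewrite !entries scale0r.
rewrite [X in _ + X + _]big1 => [|k _]; last first.
  rewrite !entries scale0r addr0.
  by case: (eqVneq k i) => [->|]; rewrite ?neq_ij ?andbF /= ?addr0 scale0r.
have /= H1 := sum_delta_lt i j (fun k l => Exy n1 n2 k l f + Exy n1 n2 l k f).
have /= H2 := sum_delta_lt j i (fun k l => Exy n1 n2 k l f + Exy n1 n2 l k f).
rewrite ij in H1; rewrite ltnNge (ltnW ij) /= in H2.
rewrite !add0r -[RHS]addr0 -[X in _ = _ + X]H2 -[X in _ = X + _]H1 -big_split /=.
apply: eq_bigr => k _.
rewrite -big_split /=; apply: eq_bigr => l _.
by rewrite !entries scale0r addr0 scalerDl.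
Qed.

Lemma sp_act_E_low i j f : (i < j)%N ->
  sp_act n1 n2 (E_low F i j + E_low F j i) f = Eyx n1 n2 i j f + Eyx n1 n2 j i f.
Proof.
move=> ij; have /negPf neq_ij : i != j by rewrite neq_ltn ij.
rewrite /sp_act /E_low.
rewrite big1 => [|k _]; last by rewrite big1 // => l _; rewrite !entries scale0r.
rewrite [X in _ + X + _]big1 => [|k _]; last first.
  rewrite !entries scale0r add0r.
  by case: (eqVneq k i) => [->|]; rewrite ?neq_ij ?andbF /= ?addr0 scale0r.
have /= H1 := sum_delta_lt i j (fun k l => Eyx n1 n2 k l f + Eyx n1 n2 l k f).
have /= H2 := sum_delta_lt j i (fun k l => Eyx n1 n2 k l f + Eyx n1 n2 l k f).
rewrite ij in H1; rewrite ltnNge (ltnW ij) /= in H2.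
rewrite !add0r -[RHS]addr0 -[X in _ = _ + X]H2 -[X in _ = X + _]H1 -big_split /=.
apply: eq_bigr => k _.
rewrite -big_split /=; apply: eq_bigr => l _.
by rewrite !entries scale0r add0r scalerDl.
Qed.

End Basis.

(* Main.v *)
Require Import Defs.
From HB Require Import structures.
From mathcomp Require Import all_boot all_order all_algebra.
From mathcomp Require Import ring zify.
From Stdlib Require Import Classical.
Import Order.TTheory GRing.Theory Num.Theory.
Local Open Scope ring_scope.

(* Howe duality.  The operators of sp(2n) are the symmetric quadratic elements
   S_ab = P_a R_b + P_b R_a of the Weyl algebra, whose generators P_a of degree 1
   and R_a of degree -1 are exchanged by a reflection; together with the Euler
   operator this reflection generates O(2), and S spans the O(2)-invariant
   quadratic elements.  All quadratic elements P_a R_b of degree 0 act irreducibly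
   on each B_k (separate the monomials by diagonal operators and move between
   them), and they are spanned by the S_ab, the skew elements
   T_ab = P_a R_b - R_a P_b and scalars.  Products of two skew elements lie in the
   algebra generated by the S_ab.  Hence every sp(2n)-submodule is T-stable as soon
   as some combination of the T_ab is invertible on it: T_(x_i, y_i) with
   n1 <= i < n2 if n1 < n2, and the Euler operator, which acts by k, if n1 = n2.
   For n1 = n2 and k = 0 the reflection itself acts on B_0, and its two eigenspaces
   are the irreducible summands.

   If n2 < n, the root vector E_(n,2n) acts by multiplication by - x_n y_n, so no
   nonzero vector is killed by it.

   If n1 = n2 = n, then gl_n commutes with gl_2 acting on the pairs (x_i, y_i), and
   B_k is the direct sum of the spaces F^s K, where F lowers the gl_2-weight and K
   consists of the gl_2-highest weight vectors of weight (a, b).  These are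
   distinguished by the degree and the Casimir element of gl_2.  Irreducibility of
   K follows by comparing the Casimir elements of gl_2 and gl_n, and the reflection
   acts on F^s K by (-1)^b. *)

Set Implicit Arguments.
Unset Strict Implicit.
Unset Printing Implicit Defensive.

(** * Subspaces *)

Section Subspaces.
Context (F : fieldType) (V : lmodType F).
Implicit Types (W S : V -> Prop) (u v : V).

Lemma subspaceZ W c u : is_subspace W -> W u -> W (c *: u).
Proof. by case=> W0 WL Wu; rewrite -[c *: u]addr0; apply: WL. Qed.

Lemma subspaceD W u v : is_subspace W -> W u -> W v -> W (u + v).
Proof. by case=> W0 WL Wu Wv; rewrite -[u]scale1r; apply: WL. Qed.

Lemma subspaceN W u : is_subspace W -> W u -> W (- u).
Proof. by move=> sW Wu; rewrite -scaleN1r; apply: subspaceZ. Qed.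

Lemma subspaceB W u v : is_subspace W -> W u -> W v -> W (u - v).
Proof. by move=> sW Wu Wv; apply: subspaceD => //; apply: subspaceN. Qed.

Lemma subspace_sum W (I : Type) (r : seq I) (P : pred I) (G : I -> V) :
  is_subspace W -> (forall i, P i -> W (G i)) -> W (\sum_(i <- r | P i) G i).
Proof.
move=> sW WG; apply: (big_ind W) => //; first by case: sW.
by move=> u v Wu Wv; apply: subspaceD.
Qed.

Lemma subspace_sum_seq W (I : eqType) (r : seq I) (G : I -> V) :
  is_subspace W -> (forall i, i \in r -> W (G i)) -> W (\sum_(i <- r) G i).
Proof.
move=> sW WG; rewrite big_seq_cond; apply: subspace_sum => // i.
by rewrite andbT; apply: WG.
Qed.

Lemma subspaceZK W c u : is_subspace W -> c != 0 -> W (c *: u) -> W u.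
Proof.
move=> sW c0 Wcu; rewrite -[u](scalerK c0).
exact: subspaceZ.
Qed.

Lemma lin_span_subspace S : is_subspace (lin_span S).
Proof.
split; first by exists [::]; rewrite big_nil.
move=> a u v [s [Ss ->]] [t [St ->]].
exists ([seq (a * x.1, x.2) | x <- s] ++ t); split.
  by move=> x; rewrite mem_cat => /orP[/mapP[y /Ss Sy ->]|/St].
by rewrite big_cat big_map scaler_sumr; congr (_ + _); apply: eq_bigr => x _;
  rewrite scalerA.
Qed.

Lemma lin_span_mem S u : S u -> lin_span S u.
Proof.
move=> Su; exists [:: (1, u)]; rewrite big_seq1 scale1r; split=> // a.
by rewrite inE => /eqP ->.
Qed.

Lemma lin_span_min S W : is_subspace W -> (forall u, S u -> W u) ->
  forall u, lin_span S u -> W u.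
Proof.
move=> sW SW u [s [Ss ->]]; apply: subspace_sum_seq => // a /Ss Sa.
by apply: subspaceZ => //; apply: SW.
Qed.

Lemma lin_span_cons u (s : seq V) w :
  lin_span (fun v => v \in u :: s) w ->
  exists c, lin_span (fun v => v \in s) (w - c *: u).
Proof.
pose P w := exists c, lin_span (fun v => v \in s) (w - c *: u).
have sS := lin_span_subspace (fun v => v \in s).
have sP : is_subspace P.
  split; first by exists 0; rewrite scale0r subr0; case: sS.
  move=> a x y [c Hc] [d Hd]; exists (a * c + d).
  rewrite scalerDl -scalerA opprD addrACA -scalerBr.
  by case: sS => _; apply.
apply: (lin_span_min sP) => v; rewrite inE => /predU1P[->|vs].
  by exists 1; rewrite scale1r subrr; case: sS.
by exists 0; rewrite scale0r subr0; apply: lin_span_mem.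
Qed.

(** [fin_dim] asks for a spanning family inside W, whereas s may lie outside. Generators are
    exchanged one at a time: a vector [w0] of W outside the span of the tail can be used to remove
    the head u from all other vectors of W; without such a vector the tail already suffices. *)
Lemma fin_dim_sub (s : seq V) W : is_subspace W ->
  (forall w, W w -> lin_span (fun v => v \in s) w) -> fin_dim W.
Proof.
elim: s W => [|u s IHs] W sW Ws.
  by exists [::]; split.
pose W' w := W w /\ lin_span (fun v => v \in s) w.
have sS := lin_span_subspace (fun v => v \in s).
have sW' : is_subspace W'.
  split; first by split; [case: sW | case: sS].
  by move=> a x y [Wx Sx] [Wy Sy]; split; [apply: (proj2 sW) | apply: (proj2 sS)].
have [t [tW' W't]] : fin_dim W' by apply: IHs => // w [].
have [[w0 [Ww0 w0s]]|noW] := classic (exists w0, W w0 /\ ~ lin_span (fun v => v \in s) w0).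
  have [c0 Hc0] := lin_span_cons (Ws _ Ww0).
  have c0N : c0 != 0.
    by apply/eqP => c00; move: Hc0; rewrite c00 scale0r subr0.
  exists (w0 :: t); split.
    by move=> v; rewrite inE => /predU1P[->|/tW' []].
  move=> w Ww; have [c Hc] := lin_span_cons (Ws _ Ww).
  have W'w : W' (w - (c / c0) *: w0).
    split; first by apply: subspaceB => //; apply: subspaceZ.
    have -> : w - (c / c0) *: w0 = (w - c *: u) - (c / c0) *: (w0 - c0 *: u).
      by rewrite scalerBr scalerA mulfVK // opprB addrA subrK.
    by apply: subspaceB => //; apply: subspaceZ.
  have sT := lin_span_subspace (fun v => v \in w0 :: t).
  rewrite -[w](subrK ((c / c0) *: w0)); apply: subspaceD => //; last first.
    by apply: subspaceZ => //; apply: lin_span_mem; rewrite mem_head.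
  apply: lin_span_min (W't _ W'w) => // v vt.
  by apply: lin_span_mem; rewrite inE vt orbT.
exists t; split=> [v /tW' []//|w Ww]; apply: W't; split=> //.
by apply: NNPP => nw; apply: noW; exists w.
Qed.

(** Regroups a linear combination so that each index occurs once, the form of sum that
    [is_direct_sum] requires. *)
Lemma lin_span_family (I : eqType) (U : I -> V -> Prop) v :
  (forall i, is_subspace (U i)) -> lin_span (fun u => exists i, U i u) v ->
  exists (s : seq I) (u : I -> V),
    [/\ uniq s, forall i, U i (u i) & v = \sum_(i <- s) u i].
Proof.
move=> sU; pose P v := exists (s : seq I) (u : I -> V),
  [/\ uniq s, forall i, U i (u i) & v = \sum_(i <- s) u i].
have extend s t (u : I -> V) : uniq s -> uniq t -> {subset s <= t} ->
    \sum_(i <- s) u i = \sum_(i <- t) (if i \in s then u i else 0).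
  move=> us ut st; rewrite -big_mkcond /= -[RHS]big_filter; apply: perm_big.
  apply: uniq_perm; rewrite ?filter_uniq // => i; rewrite mem_filter.
  by case: (boolP (i \in s)) => // /st ->.
apply: (@lin_span_min _ P); first split.
- by exists [::], (fun=> 0); rewrite big_nil; split=> // i; case: (sU i).
- move=> a x y [s [u [us Uu ->]]] [t [w [ut Uw ->]]].
  pose r := undup (s ++ t).
  rewrite (extend s r) ?undup_uniq //; last first.
    by move=> i si; rewrite mem_undup mem_cat si.
  rewrite (extend t r) ?undup_uniq //; last first.
    by move=> i ti; rewrite mem_undup mem_cat ti orbT.
  rewrite scaler_sumr -big_split /=.
  exists r, (fun i => a *: (if i \in s then u i else 0)
                      + (if i \in t then w i else 0)).
  rewrite undup_uniq; split=> // i; case: (sU i) => U0 UL.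
  by apply: UL; case: ifP.
- move=> u [i Ui]; exists [:: i], (fun j => if j == i then u else 0).
  rewrite big_seq1 eqxx; split=> // j.
  by case: eqP => [->|_] //; case: (sU j).
Qed.

(** No single operator has to separate all indices. To remove k from a relation, a [j] separating i
    and k is chosen; [L j - lam j k] kills the k-th vector and only rescales the others, the i-th by
    a nonzero factor. *)
Lemma eigenvectors_free (I : eqType) (J : Type) (L : J -> V -> V)
    (lam : J -> I -> F) (s : seq I) :
  (forall j, linear (L j)) -> uniq s ->
  (forall i k, i \in s -> k \in s -> i != k ->
     exists j, lam j i != lam j k) ->
  forall u : I -> V, (forall i j, L j (u i) = lam j i *: u i) ->
  \sum_(i <- s) u i = 0 -> forall i, i \in s -> u i = 0.
Proof.
move=> linL us sep u Lu sum0 i si.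
suff free t : {subset t <= s} -> i \notin t ->
    forall w : I -> V, (forall k j, L j (w k) = lam j k *: w k) ->
    w i + \sum_(k <- t) w k = 0 -> w i = 0.
  apply: (free (rem i s) _ _ u Lu).
  - by move=> k /mem_rem.
  - by rewrite mem_rem_uniq // !inE eqxx.
  - by move: sum0; rewrite (perm_big _ (perm_to_rem si)) big_cons.
elim: t => [|k t IHt] ts it w Lw.
  by rewrite big_nil addr0.
rewrite big_cons => sumw; move: it; rewrite inE negb_or => /andP[ik it].
have [j sepj] := sep i k si (ts _ (mem_head _ _)) ik.
have c0 : lam j i - lam j k != 0 by rewrite subr_eq0.
have lin0 : L j 0 = 0.
  by have := linL j (-1) 0 0; rewrite scaler0 addr0 scaleN1r addNr.
have linD x y : L j (x + y) = L j x + L j y.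
  by have := linL j 1 x y; rewrite !scale1r.
have wi0 : (lam j i - lam j k) *: w i = 0.
  apply: (IHt _ it (fun i => (lam j i - lam j k) *: w i)).
  - by move=> x xt; apply: ts; rewrite inE xt orbT.
  - move=> x j'; have := linL j' (lam j x - lam j k) (w x) 0.
    have l0 : L j' 0 = 0.
      by have := linL j' (-1) 0 0; rewrite scaler0 addr0 scaleN1r addNr.
    by rewrite addr0 l0 addr0 Lw !scalerA mulrC.
  - have Lsum : L j (w i + (w k + \sum_(j <- t) w j))
                - lam j k *: (w i + (w k + \sum_(j <- t) w j)) = 0.
      by rewrite sumw lin0 scaler0 subrr.
    have Lbig : L j (\sum_(k <- t) w k) = \sum_(k <- t) lam j k *: w k.
      have -> : L j (\sum_(k <- t) w k) = \sum_(k <- t) L j (w k).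
        exact: (big_morph (L j) linD lin0).
      by apply: eq_bigr => x _.
    move: Lsum; rewrite !linD !Lw Lbig !scalerDr.
    rewrite opprD addrACA -scalerBl opprD [X in _ + X]addrACA subrr add0r.
    rewrite scaler_sumr -sumrB => Lsum; rewrite -[RHS]Lsum; congr (_ + _).
    by apply: eq_bigr => x _; rewrite scalerBl.
by move/eqP: wi0; rewrite scaler_eq0 (negPf c0) /= => /eqP.
Qed.

End Subspaces.

(** * Operators diagonal on monomials and their weight vectors *)

Section Diagonal.
Context (F : fieldType) (charF : [pchar F] =i pred0) (N : nat).
Notation V := {mpoly F[N]}.

Lemma natf_eq0 (k : nat) : (k%:R == 0 :> F) = (k == 0%N).
Proof. by move/pcharf0P: charF => ->. Qed.

Lemma intf_eq0 (z : int) : (z%:~R == 0 :> F) = (z == 0).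
Proof.
by case: z => k; rewrite ?NegzE ?mulrNz ?oppr_eq0 -pmulrn natf_eq0.
Qed.

Lemma intf_inj : injective (fun z : int => z%:~R : F).
Proof.
by move=> x y /eqP; rewrite -subr_eq0 -intrB intf_eq0 subr_eq0 => /eqP.
Qed.

Lemma mcoeff_diag (T : {linear V -> V}) (phi : 'X_{1..N} -> F) f m :
  (forall m, T 'X_[m] = phi m *: 'X_[m]) -> (T f)@_m = phi m * f@_m.
Proof.
move=> TX; rewrite {1 2}[f]mpolyE !linear_sum /= mulr_sumr.
apply: eq_bigr => k _; rewrite linearZ /= TX !mcoeffZ mcoeffX.
by case: eqP => [->|_]; rewrite ?mulr0 // !mulr1 mulrC.
Qed.

Lemma msupp_size_ltn (f g : V) m : {subset msupp g <= msupp f} ->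
  m \in msupp f -> m \notin msupp g -> (size (msupp g) < size (msupp f))%N.
Proof.
move=> gf mf mg; rewrite -[_.+1]/(size (m :: msupp g)).
apply: uniq_leq_size => [|k]; first by rewrite /= mg msupp_uniq.
by rewrite inE => /predU1P[->|/gf].
Qed.

(* In other words, U is spanned by its weight vectors. *)
Lemma diag_ind (J : Type) (T : J -> V -> V) (phi : J -> 'X_{1..N} -> F)
    (U W : V -> Prop) :
  (forall j f m, (T j f)@_m = phi j m * f@_m) ->
  is_subspace U -> is_subspace W -> (forall j f, U f -> U (T j f)) ->
  (forall g, U g -> g != 0 ->
     (forall m j, m \in msupp g -> T j g = phi j m *: g) -> W g) ->
  forall f, U f -> W f.
Proof.
move=> Tphi sU sW UT UW f; move: {2}_.+1 (ltnSn (size (msupp f))) => k.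
elim: k f => // k IHk f; rewrite ltnS => szf Uf.
have [[m [m' [j [mf m'f phi_neq]]]]|homo] := classic (exists m m' j,
    [/\ m \in msupp f, m' \in msupp f & phi j m != phi j m']).
  have c0 : phi j m - phi j m' != 0 by rewrite subr_eq0.
  (* Lagrange interpolation for two weights: g keeps the coefficient of m and loses that of m', so
     both g and f - g have smaller support than f. *)
  pose g := (phi j m - phi j m')^-1 *: (T j f - phi j m' *: f).
  have gE p : g@_p = (phi j m - phi j m')^-1 * (phi j p - phi j m') * f@_p.
    by rewrite mcoeffZ mcoeffB Tphi mcoeffZ -mulrBl mulrA.
  have Ug : U g.
    by apply: subspaceZ => //; apply: subspaceB; [|apply: UT|apply: subspaceZ].
  have supp_le (h : V) : (forall p, f@_p = 0 -> h@_p = 0) ->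
      {subset msupp h <= msupp f}.
    move=> h0 p; rewrite !mcoeff_msupp; apply: contra => /eqP fp.
    by rewrite h0.
  rewrite -[f](subrK g); apply: subspaceD => //; apply: IHk.
  - apply: leq_trans szf; apply: (msupp_size_ltn _ mf).
      by apply: supp_le => p fp; rewrite mcoeffB gE fp mulr0 subr0.
    by rewrite -mcoeff_eq0 mcoeffB gE mulVf // mul1r subrr.
  - exact: subspaceB.
  - apply: leq_trans szf; apply: (msupp_size_ltn _ m'f).
      by apply: supp_le => p fp; rewrite gE fp mulr0.
    by rewrite -mcoeff_eq0 gE subrr mulr0 mul0r.
  - exact: Ug.
have [->|f0] := eqVneq f 0; first by case: sW.
apply: UW => // m j mf; apply/mpolyP => p; rewrite Tphi mcoeffZ.
have [pf|/memN_msupp_eq0 ->] := boolP (p \in msupp f); last by rewrite !mulr0.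
congr (_ * _); apply/eqP/negPn/negP => neq; apply: homo.
by exists p, m, j.
Qed.

(** By [diag_ind] with W = 0: a stable subspace without nonzero weight vectors is zero. *)
Lemma diag_exists (J : Type) (T : J -> V -> V) (phi : J -> 'X_{1..N} -> F)
    (U : V -> Prop) f :
  (forall j f m, (T j f)@_m = phi j m * f@_m) ->
  is_subspace U -> (forall j f, U f -> U (T j f)) -> U f -> f != 0 ->
  exists g, [/\ U g, g != 0
    & forall m j, m \in msupp g -> T j g = phi j m *: g].
Proof.
move=> Tphi sU UT Uf f0; apply: NNPP => none; case/eqP: f0.
pose Z (g : V) := g = 0.
have sZ : is_subspace Z.
  by split=> // a u v -> ->; rewrite /Z scaler0 addr0.
apply: (diag_ind Tphi sU sZ UT) Uf => g Ug g0 gT; case: none.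
by exists g.
Qed.

Lemma msupp_neq0 (f : V) : f != 0 -> exists m, m \in msupp f.
Proof.
rewrite -msupp_eq0; case: (msupp f) => // m s _; exists m.
exact: mem_head.
Qed.

End Diagonal.

(** * Weyl algebra operators *)

Section Weyl.
Context (F : fieldType) (charF : [pchar F] =i pred0) (n n1 n2 : nat).
Notation V := {mpoly F[n + n]}.
Notation A := (bool * 'I_n)%type.
Implicit Types (a b c d : A) (f g : V).

(* The index (true, i) stands for x_i and (false, i) for y_i. *)
Definition gen a : 'I_(n + n) := if a.1 then lshift n a.2 else rshift n a.2.

Lemma gen_inj : injective gen.
Proof.
move=> [[] i] [[] j]; rewrite /gen /= => /eqP;
  by rewrite ?eq_lshift ?eq_rshift ?eq_lrshift ?eq_rlshift // => /eqP ->.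
Qed.

Lemma gen_surj (k : 'I_(n + n)) : exists a, k = gen a.
Proof.
rewrite -(splitK k); case: (split k) => i.
  by exists (true, i).
by exists (false, i).
Qed.

(** The variables on which multiplication and differentiation exchange roles. There the pair (P, Q)
    is (derivative, minus multiplication), so the canonical relation between Q and P is the same for
    all variables. *)
Definition twisted a : bool := if a.1 then (a.2 < n1)%N else (n2 <= a.2)%N.

Definition Pop a f : V := if twisted a then f^`M(gen a) else 'X_(gen a) * f.
Definition Qop a f : V := if twisted a then - ('X_(gen a) * f) else f^`M(gen a).
(** Q relabelled by exchanging x_i and y_i, with a sign that turns the commutator of R and P into a
    symplectic form. *)
Definition Rop a f : V := if a.1 then Qop (false, a.2) f else - Qop (true, a.2) f.

Lemma Pop_linear a : linear (Pop a).
Proof.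
move=> k f g; rewrite /Pop; case: ifP => _; first by rewrite linearP.
by rewrite mulrDr scalerAr.
Qed.
HB.instance Definition _ a := GRing.isLinear.Build F V V _ (Pop a) (Pop_linear a).

Lemma Qop_linear a : linear (Qop a).
Proof.
move=> k f g; rewrite /Qop; case: ifP => _; last by rewrite linearP.
by rewrite mulrDr scalerN scalerAr opprD.
Qed.
HB.instance Definition _ a := GRing.isLinear.Build F V V _ (Qop a) (Qop_linear a).

Lemma Rop_linear a : linear (Rop a).
Proof.
move=> k f g; rewrite /Rop; case: ifP => _; first by rewrite linearP.
by rewrite linearP opprD scalerN.
Qed.
HB.instance Definition _ a := GRing.isLinear.Build F V V _ (Rop a) (Rop_linear a).

Lemma PopD a f g : Pop a (f + g) = Pop a f + Pop a g.
Proof. exact: linearD. Qed.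

Lemma PopN a f : Pop a (- f) = - Pop a f.
Proof. exact: linearN. Qed.

Lemma PopZ a k f : Pop a (k *: f) = k *: Pop a f.
Proof. exact: linearZ. Qed.

Lemma RopD a f g : Rop a (f + g) = Rop a f + Rop a g.
Proof. exact: linearD. Qed.

Lemma RopN a f : Rop a (- f) = - Rop a f.
Proof. exact: linearN. Qed.

Lemma RopZ a k f : Rop a (k *: f) = k *: Rop a f.
Proof. exact: linearZ. Qed.

Lemma QopD a f g : Qop a (f + g) = Qop a f + Qop a g.
Proof. exact: linearD. Qed.

Lemma QopZ a k f : Qop a (k *: f) = k *: Qop a f.
Proof. exact: linearZ. Qed.

Lemma mderiv_gen a b : ('X_(gen b) : V)^`M(gen a) = (a == b)%:R%:MP.
Proof.
rewrite mderivX mnm1E (inj_eq gen_inj) eq_sym.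
case: eqP => [->|_]; last by rewrite scale0r mpolyC0.
rewrite scale1r (_ : (_ - _)%MM = 0%MM) ?mpolyX0 ?mpolyC1 //.
by apply/mnmP => i; rewrite mnmBE subnn mnm0E.
Qed.

Lemma mderiv_genM a b f :
  ('X_(gen b) * f)^`M(gen a) = 'X_(gen b) * f^`M(gen a) + (a == b)%:R *: f.
Proof. by rewrite mderivM mderiv_gen mul_mpolyC addrC. Qed.

Lemma PopC a b f : Pop a (Pop b f) = Pop b (Pop a f).
Proof.
have [->//|ab] := eqVneq a b; rewrite /Pop.
case: (twisted a) (twisted b) => [] [].
- exact: mderiv_comm.
- by rewrite mderiv_genM (negPf ab) scale0r addr0.
- by rewrite mderiv_genM eq_sym (negPf ab) scale0r addr0.
- by rewrite mulrCA.
Qed.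

Lemma QopC a b f : Qop a (Qop b f) = Qop b (Qop a f).
Proof.
have [->//|ab] := eqVneq a b; rewrite /Qop.
case: (twisted a) (twisted b) => [] [].
- by rewrite !mulrN mulrCA.
- by rewrite mderivN mderiv_genM eq_sym (negPf ab) scale0r addr0.
- by rewrite mderivN mderiv_genM (negPf ab) scale0r addr0.
- exact: mderiv_comm.
Qed.

Lemma QopP a b f : Qop a (Pop b f) = Pop b (Qop a f) + (a == b)%:R *: f.
Proof.
have [->|ab] := eqVneq a b; rewrite /Qop /Pop.
  case: (twisted b); rewrite ?mderivN mderiv_genM eqxx // opprD subrK //.
case: (twisted a) (twisted b) => [] [];
  rewrite ?mderivN ?mderiv_genM ?[b == a]eq_sym ?(negPf ab) ?scale0r ?addr0 //.
- by rewrite mulrN mulrCA.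
- exact: mderiv_comm.
Qed.

(** The matrix of the standard symplectic form: 1 on (x_i, y_i), -1 on (y_i, x_i), zero
    elsewhere. *)
Definition om a b : F :=
  (a.2 == b.2)%:R * (a.1%:R - b.1%:R).

Lemma omC a b : om b a = - om a b.
Proof. by rewrite /om eq_sym -mulrN opprB. Qed.

Lemma RopP a b f : Rop a (Pop b f) = Pop b (Rop a f) + om a b *: f.
Proof.
case: a b => [[] i] [[] j]; rewrite /Rop /om /= ?linearN /= QopP;
  rewrite xpair_eqE ?(subrr, subr0, sub0r, mulr0, mulr1, mulrN1) ?andbT //=.
all: by rewrite ?opprD ?scaleNr ?scale0r ?oppr0.
Qed.

Lemma RopC a b f : Rop a (Rop b f) = Rop b (Rop a f).
Proof.
by case: a b => [[] i] [[] j]; rewrite /Rop /= ?linearN /= QopC.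
Qed.

Definition Sop a b f : V := Pop a (Rop b f) + Pop b (Rop a f).
(* Invariant and anti-invariant quadratic operators for the reflection
   P <-> R of the Weyl algebra, which generates O(2) together with the Euler
   operator; the scalar makes [Top] equal to P_a R_b - R_a P_b. *)
Definition Top a b f : V := Pop a (Rop b f) - Pop b (Rop a f) - om a b *: f.

Lemma omZC a b f : om b a *: f = - (om a b *: f).
Proof. by rewrite omC scaleNr. Qed.

(* First fundamental theorem for O(2): the product of two skew operators lies in
   the algebra generated by the invariant ones. *)
Lemma Top_Top a b c d f :
  Top a b (Top c d f) =
  Sop a d (Sop b c f) - Sop a c (Sop b d f)
  - om a c *: Sop b d f + om a d *: Sop b c f + om c d *: Sop a b f
  + om a b *: (om c d *: f).
Proof.
rewrite /Top /Sop.
(* Normal ordering: every P is moved to the left of every R, then commuting factors are put in a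
   fixed order, so that [ring] sees equal atoms. *)
do ![rewrite !(PopD, PopN, PopZ, RopD, RopN, RopZ, RopP)].
rewrite ?(RopC d b) ?(RopC c b) ?(RopC d a) ?(RopC c a) ?(RopC d c) ?(RopC b a).
rewrite ?(PopC d b) ?(PopC c b) ?(PopC d a) ?(PopC c a) ?(PopC d c) ?(PopC b a).
rewrite !(omZC a b, omZC a c, omZC a d, omZC b c, omZC b d, omZC c d).
rewrite -!mul_mpolyC; ring.
Qed.

(** The commutator of an invariant and a skew operator is a combination of skew ones, so the image
    of a submodule under all [T] is again stable under [S]. *)
Lemma Sop_Top a b c d f :
  Sop a b (Top c d f) = Top c d (Sop a b f)
  + om b c *: Top a d f + om a c *: Top b d f
  + om b d *: Top c a f + om a d *: Top c b f.
Proof.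
rewrite /Top /Sop.
do ![rewrite !(PopD, PopN, PopZ, RopD, RopN, RopZ, RopP)].
rewrite ?(RopC d b) ?(RopC c b) ?(RopC d a) ?(RopC c a) ?(RopC d c) ?(RopC b a).
rewrite ?(PopC d b) ?(PopC c b) ?(PopC d a) ?(PopC c a) ?(PopC d c) ?(PopC b a).
rewrite ?(omZC a b, omZC a c, omZC a d, omZC b c, omZC b d, omZC c d).
rewrite -!mul_mpolyC; ring.
Qed.

End Weyl.

(** * The symplectic action in terms of the Weyl generators *)

Section Symplectic.
Context (F : fieldType) (charF : [pchar F] =i pred0) (n n1 n2 : nat).
Notation V := {mpoly F[n + n]}.
Notation A := (bool * 'I_n)%type.
Notation P := (@Pop F n n1 n2).
Notation Q := (@Qop F n n1 n2).
Notation R := (@Rop F n n1 n2).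
Notation S := (@Sop F n n1 n2).
Notation T := (@Top F n n1 n2).
Implicit Types (a b c d : A) (f g : V) (i j : 'I_n) (m : 'X_{1..n + n}).

(** The four cases of the definition are one product; the Kronecker delta appears when the
    derivative is moved past the variable. *)
Lemma ExE i j f : Ex n1 i j f = P (true, i) (Q (true, j) f).
Proof.
rewrite /Ex /Pop /Qop /twisted /=; case: ifP => i1; case: ifP => j1 //.
  rewrite mderivN /dX /xvar -/(gen (true, i)) -/(gen (true, j)).
  by rewrite mderiv_genM opprD scaler_nat xpair_eqE.
by rewrite mulrN mulrA.
Qed.

Lemma EyE i j f : Ey n2 i j f = P (false, i) (Q (false, j) f).
Proof.
rewrite /Ey /Pop /Qop /twisted /= ![(n2 <= _)%N]leqNgt.
case: ifP => i2; case: ifP => j2 //=.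
  by rewrite mulrN mulrA.
rewrite mderivN /dY /yvar -/(gen (false, i)) -/(gen (false, j)).
by rewrite mderiv_genM opprD scaler_nat xpair_eqE.
Qed.

Lemma ExyE i j f : Exy n1 n2 i j f = P (true, i) (Q (false, j) f).
Proof.
rewrite /Exy /Pop /Qop /twisted /= ![(n2 <= _)%N]leqNgt.
case: ifP => i1; case: ifP => j2 //=; last by rewrite mulrN mulrA.
rewrite mderivN /dX /yvar -/(gen (true, i)) -/(gen (false, j)).
by rewrite mderiv_genM scale0r addr0.
Qed.

Lemma EyxE i j f : Eyx n1 n2 i j f = P (false, i) (Q (true, j) f).
Proof.
rewrite /Eyx /Pop /Qop /twisted /= ![(n2 <= _)%N]leqNgt.
case: ifP => j1; case: ifP => i2 //=.
- by rewrite mulrN mulrA [X in X * f]mulrC.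
- rewrite mderivN /dY /xvar -/(gen (false, i)) -/(gen (true, j)).
  by rewrite mderiv_genM scale0r addr0.
- by rewrite /dX /dY mderiv_comm.
Qed.

Lemma SopC a b f : S a b f = S b a f.
Proof. by rewrite /Sop addrC. Qed.

Lemma two_neq0 : (2%:R : F) != 0.
Proof. by rewrite natf_eq0. Qed.

Lemma gl_root_sp i j : gl_root F i j \in sp_alg F n.
Proof.
rewrite /sp_alg -addvA memvE; apply: subv_trans (addvSl _ _).
by rewrite /K_alg; apply: (sumv_sup i) => //; apply: (sumv_sup j).
Qed.

Lemma E_up_sp i j : E_up F i j + E_up F j i \in sp_alg F n.
Proof.
wlog ij : i j / (i <= j)%N.
  by move=> H; have [/H//|/ltnW /H] := leqP i j; rewrite addrC.
rewrite /sp_alg; move: ij; rewrite leq_eqVlt => /orP[/eqP ij|ij].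
  have {j ij}<- : i = j by apply: val_inj.
  have : (<[E_up F i i]> <= sp_alg F n)%VS.
    apply: subv_trans (addvSl _ _); apply: subv_trans (addvSr _ _).
    by apply: (sumv_sup i) => //; apply: addvSl.
  by rewrite -memvE => up; apply: memvD.
rewrite memvE; apply: subv_trans (addvSr _ _).
apply: (sumv_sup i) => //; apply: (sumv_sup j) => //.
exact: addvSl.
Qed.

Lemma E_low_sp i j : E_low F i j + E_low F j i \in sp_alg F n.
Proof.
wlog ij : i j / (i <= j)%N.
  by move=> H; have [/H//|/ltnW /H] := leqP i j; rewrite addrC.
rewrite /sp_alg; move: ij; rewrite leq_eqVlt => /orP[/eqP ij|ij].
  have {j ij}<- : i = j by apply: val_inj.
  have : (<[E_low F i i]> <= sp_alg F n)%VS.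
    apply: subv_trans (addvSl _ _); apply: subv_trans (addvSr _ _).
    by apply: (sumv_sup i) => //; apply: addvSr.
  by rewrite -memvE => low; apply: memvD.
rewrite memvE; apply: subv_trans (addvSr _ _).
apply: (sumv_sup i) => //; apply: (sumv_sup j) => //.
exact: addvSr.
Qed.

Lemma sp_act_linear f k M M' :
  sp_act n1 n2 (k *: M + M') f = k *: sp_act n1 n2 M f + sp_act n1 n2 M' f.
Proof.
rewrite /sp_act !scalerDr !scaler_sumr.
set x1 := (X in X + _ + _ = _); set x2 := (X in _ + X + _ = _).
set x3 := (X in _ + _ + X = _); set y1 := (X in _ = X + _ + _ + _).
set y2 := (X in _ = _ + X + _ + _); set y3 := (X in _ = _ + _ + X + _).
set z1 := (X in _ = _ + (X + _ + _)); set z2 := (X in _ = _ + (_ + X + _)).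
set z3 := (X in _ = _ + (_ + _ + X)).
have -> : y1 + y2 + y3 + (z1 + z2 + z3) = (y1 + z1) + (y2 + z2) + (y3 + z3).
  by rewrite addrACA [y1 + y2 + _]addrACA.
congr (_ + _ + _); rewrite -big_split; apply: eq_bigr => i _ /=.
- rewrite scaler_sumr -big_split; apply: eq_bigr => j _ /=.
  by rewrite !mxE scalerDl -scalerA.
- by rewrite !mxE !scalerDl scalerDr -!scalerA addrACA.
- rewrite scaler_sumr -big_split; apply: eq_bigr => j _ /=.
  by rewrite !mxE !scalerDl (scalerDr k) -!scalerA addrACA.
Qed.

Lemma sp_actD M M' f :
  sp_act n1 n2 (M + M') f = sp_act n1 n2 M f + sp_act n1 n2 M' f.
Proof. by have := sp_act_linear f 1 M M'; rewrite !scale1r. Qed.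

Lemma sp_act_up i j f :
  sp_act n1 n2 (E_up F i j + E_up F j i) f = S (true, i) (true, j) f.
Proof.
rewrite /Sop /Rop /= -!ExyE.
have [ij|ji|/val_inj ->] := ltngtP i j.
- exact: sp_act_E_up.
- by rewrite addrC sp_act_E_up // addrC.
- by rewrite sp_actD !sp_act_E_up_diag.
Qed.

Lemma sp_act_low i j f :
  sp_act n1 n2 (E_low F i j + E_low F j i) f = - S (false, i) (false, j) f.
Proof.
rewrite /Sop /Rop /= !PopN -!EyxE opprD !opprK.
have [ij|ji|/val_inj ->] := ltngtP i j.
- exact: sp_act_E_low.
- by rewrite addrC sp_act_E_low // addrC.
- by rewrite sp_actD !sp_act_E_low_diag.
Qed.

Lemma sp_act_gl i j f :
  sp_act n1 n2 (gl_root F i j) f = - S (true, i) (false, j) f.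
Proof.
rewrite sp_act_gl_root /Sop /Rop /= PopN ExE EyE.
by rewrite opprD opprK.
Qed.

Lemma sp_submoduleP (W : V -> Prop) :
  is_submodule (@sp_act F n n1 n2) (sp_alg F n) W <->
  is_subspace W /\ forall a b f, W f -> W (S a b f).
Proof.
split=> -[sW Wact]; split=> //.
  have gl i j f : W f -> W (S (true, i) (false, j) f).
    move=> Wf; rewrite -[S _ _ _]opprK -sp_act_gl.
    by apply: subspaceN => //; apply/Wact => //; apply: gl_root_sp.
  move=> [[] i] [[] j] f Wf.
  - by rewrite -sp_act_up; apply/Wact => //; apply: E_up_sp.
  - exact: gl.
  - by rewrite SopC; apply: gl.
  - rewrite -[S _ _ _]opprK -sp_act_low.
    by apply: subspaceN => //; apply/Wact => //; apply: E_low_sp.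
move=> M f _ Wf; rewrite /sp_act; apply: subspaceD => //; first apply: subspaceD => //.
- apply: subspace_sum => // i _; apply: subspace_sum => // j _.
  apply: subspaceZ => //; rewrite -sp_act_gl_root sp_act_gl.
  by apply: subspaceN => //; apply: Wact.
- apply: subspace_sum => // i _; apply: subspaceD => //; apply: subspaceZ => //.
    (* [S] at a repeated index is twice the action of the basis element, so 2 has to be divided
       out. *)
    apply: (subspaceZK sW two_neq0); rewrite scaler_nat mulr2n.
    by rewrite -sp_act_E_up_diag -sp_actD sp_act_up; apply: Wact.
  apply: (subspaceZK sW two_neq0); rewrite scaler_nat mulr2n.
  rewrite -sp_act_E_low_diag -sp_actD sp_act_low.
  by apply: subspaceN => //; apply: Wact.
- apply: subspace_sum => // i _; apply: subspace_sum => // j ij.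
  apply: subspaceD => //; apply: subspaceZ => //.
    by rewrite -sp_act_E_up // sp_act_up; apply: Wact.
  rewrite -sp_act_E_low // sp_act_low.
  by apply: subspaceN => //; apply: Wact.
Qed.

Lemma PQ_stable (W : V -> Prop) : is_subspace W ->
  (forall a b f, W f -> W (S a b f)) -> (forall a b f, W f -> W (T a b f)) ->
  forall a b f, W f -> W (P a (Q b f)).
Proof.
move=> sW WS WT.
have WPR a b f : W f -> W (P a (R b f)).
  move=> Wf; apply: (subspaceZK sW two_neq0).
  have -> : 2%:R *: P a (R b f) = S a b f + T a b f + om F a b *: f.
    by rewrite /Sop /Top scaler_nat mulr2n -!mul_mpolyC; ring.
  apply: (subspaceD sW); last exact: subspaceZ.
  by apply: (subspaceD sW); [apply: WS | apply: WT].
move=> a [[] i] f Wf; last exact: (WPR a (true, i)).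
rewrite -[P _ _]opprK; apply: subspaceN => //.
by rewrite -PopN; apply: (WPR a (false, i)).
Qed.

End Symplectic.

(** * Grading *)

Section Grading.
Context (F : fieldType) (charF : [pchar F] =i pred0) (n n1 n2 : nat).
Notation V := {mpoly F[n + n]}.
Notation A := (bool * 'I_n)%type.
Notation P := (@Pop F n n1 n2).
Notation Q := (@Qop F n n1 n2).
Notation R := (@Rop F n n1 n2).
Notation S := (@Sop F n n1 n2).
Notation T := (@Top F n n1 n2).
Notation tw := (@twisted n n1 n2).
Notation gr := (@grade n n1 n2).
Notation Bk := (@B_part F n n1 n2).
Implicit Types (a b c d : A) (f g : V) (i j : 'I_n) (m : 'X_{1..n + n}).

Lemma mcoeff_numop (k : 'I_(n + n)) f m : ('X_k * f^`M(k))@_m = (m k)%:R * f@_m.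
Proof.
pose N (g : V) : V := 'X_k * g^`M(k).
have linN : linear N by move=> c g h; rewrite /N linearP mulrDr scalerAr.
pose HN := GRing.isLinear.Build F V V *:%R N linN.
pose N' : {linear V -> V} := HB.pack N HN.
rewrite -[LHS]/((N' f)@_m); apply: (@mcoeff_diag F _ N' (fun m => (m k)%:R)).
move=> p; rewrite /= /N mderivX -scalerAr -mpolyXD.
have [pk0|pk] := eqVneq (p k) 0%N; first by rewrite pk0 !scale0r.
congr (_ *: 'X_[_]); apply/mnmP => l; rewrite mnmDE mnmBE mnm1E.
by case: eqP => [<-|_]; rewrite ?add0n ?subn0 // subnKC // lt0n.
Qed.

Definition eps a : int := if tw a then -1 else 1.

(** The eigenvalue of P_a Q_a on a monomial. On a twisted variable the derivative acts after the
    multiplication, which shifts the exponent by one. *)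
Definition weight a m : int := eps a * (m (gen a))%:Z - (tw a)%:Z.

Lemma mcoeff_PQ a f m : (P a (Q a f))@_m = (weight a m)%:~R * f@_m.
Proof.
rewrite /Pop /Qop /weight /eps; case: (tw a).
  rewrite mderivN mderiv_genM eqxx scale1r mcoeffN mcoeffD mcoeff_numop.
  by rewrite mulN1r intrB intrN mulrBl mulNr mul1r opprD.
by rewrite mcoeff_numop mul1r subr0.
Qed.

Lemma gradeE m : gr m = \sum_a eps a * (m (gen a))%:Z.
Proof.
rewrite -(pair_bigA _ (fun t i => eps (t, i) * (m (gen (t, i)))%:Z)) /=.
rewrite big_bool /= /grade /eps /twisted /gen /= -sumrN.
rewrite (bigID (fun i : 'I_n => (i < n1)%N) xpredT) /= -!addrA.
congr (_ + (_ + _)).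
- by apply: eq_bigr => i ->; rewrite mulN1r.
- by apply: eq_big => i; [rewrite -leqNgt|rewrite leqNgt => /negPf ->; rewrite mul1r].
rewrite (bigID (fun i : 'I_n => (i < n2)%N) xpredT) /= -sumrN.
congr (_ + _).
- by apply: eq_bigr => i; rewrite ltnNge => /negPf ->; rewrite mul1r.
- by apply: eq_big => i; [rewrite -leqNgt|move=> ->; rewrite mulN1r].
Qed.

Lemma B_partP k f : Bk k f <-> (forall m, m \in msupp f -> gr m = k).
Proof.
split.
  move: f; apply: lin_span_min; first split.
  - by move=> m; rewrite msupp0.
  - move=> c f g Hf Hg m /msuppD_le; rewrite mem_cat => /orP[|/Hg //].
    by move/msuppZ_le/Hf.
  - by move=> _ [m mk ->] p; rewrite msuppX inE => /eqP ->.
move=> Hf; exists [seq (f@_m, 'X_[m]) | m <- msupp f]; split.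
  by move=> _ /mapP[m mf ->]; exists m => //; apply: Hf.
by rewrite big_map /= -mpolyE.
Qed.

(** The added scalars cancel the shift in [weight], so that the eigenvalue on a monomial is exactly
    its grade. *)
Definition euler f : V := \sum_a (P a (Q a f) + (tw a)%:R *: f).

Lemma mcoeff_euler f m : (euler f)@_m = (gr m)%:~R * f@_m.
Proof.
rewrite /euler raddf_sum gradeE rmorph_sum mulr_suml; apply: eq_bigr => a _ /=.
rewrite mcoeffD mcoeff_PQ mcoeffZ -mulrDl; congr (_ * _).
by rewrite /weight intrB subrK.
Qed.

(** Distinct integers remain distinct in characteristic 0, so B_k is a full eigenspace and stability
    of B_k becomes a commutator computation. *)
Lemma B_part_euler k f : Bk k f <-> euler f = k%:~R *: f.
Proof.
rewrite B_partP; split=> [Hf|Ef m].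
  apply/mpolyP => m; rewrite mcoeff_euler mcoeffZ.
  by have [/Hf ->//|/memN_msupp_eq0 ->] := boolP (m \in msupp f); rewrite !mulr0.
rewrite mcoeff_msupp => fm.
have := congr1 (mcoeff m) Ef; rewrite mcoeff_euler mcoeffZ => /(mulIf fm).
exact: intf_inj.
Qed.

Lemma B_part_subspace k : is_subspace (Bk k).
Proof. exact: lin_span_subspace. Qed.

Lemma euler_P b f : euler (P b f) = P b (euler f) + P b f.
Proof.
have Psum : P b (euler f) = \sum_a P b (P a (Q a f) + (tw a)%:R *: f).
  exact: linear_sum.
rewrite Psum /euler.
rewrite [X in _ = _ + X](_ : P b f = \sum_a (a == b)%:R *: P b f); last first.
  rewrite (bigD1 b) //= eqxx scale1r big1 ?addr0 // => a /negPf ->.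
  by rewrite scale0r.
rewrite -big_split; apply: eq_bigr => a _ /=.
rewrite QopP !(PopD, PopZ) (PopC _ _ a b).
have [->|ab] := eqVneq a b; last by rewrite !scale0r !addr0.
by rewrite scale1r addrAC.
Qed.

Lemma euler_Q b f : euler (Q b f) = Q b (euler f) - Q b f.
Proof.
have Qsum : Q b (euler f) = \sum_a Q b (P a (Q a f) + (tw a)%:R *: f).
  exact: linear_sum.
rewrite Qsum /euler.
rewrite [X in _ = _ - X](_ : Q b f = \sum_a (a == b)%:R *: Q b f); last first.
  rewrite (bigD1 b) //= eqxx scale1r big1 ?addr0 // => a /negPf ->.
  by rewrite scale0r.
rewrite -sumrB; apply: eq_bigr => a _ /=.
rewrite QopD QopZ QopP (QopC _ _ a b) [b == a]eq_sym.
have [->|ab] := eqVneq a b; last by rewrite !scale0r addr0 subr0.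
by rewrite !scale1r addrAC addrK.
Qed.

Lemma B_part_PQ k a b f : Bk k f -> Bk k (P a (Q b f)).
Proof.
rewrite !B_part_euler euler_P euler_Q => ->.
by rewrite !(PopD, PopN, PopZ, QopZ) subrK.
Qed.

Lemma B_part_PR k a b f : Bk k f -> Bk k (P a (R b f)).
Proof.
case: b => [[] i] Bf; rewrite /Rop /= ?PopN; first exact: B_part_PQ.
by apply: subspaceN; [apply: B_part_subspace | apply: B_part_PQ].
Qed.

Lemma B_part_S k a b f : Bk k f -> Bk k (S a b f).
Proof.
by move=> Bf; apply: subspaceD; [apply: B_part_subspace| |]; apply: B_part_PR.
Qed.

Lemma B_part_T k a b f : Bk k f -> Bk k (T a b f).
Proof.
have sB := B_part_subspace k.
move=> Bf; apply: (subspaceB sB); last exact: subspaceZ.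
by apply: (subspaceB sB); apply: B_part_PR.
Qed.

(** Measured by the signed exponent [eps b * m (gen b)], Q lowers by one whether it multiplies or
    differentiates. The hypothesis excludes only the derivative of a monomial free of the
    variable. *)
Lemma Qop_X b m : tw b || (0 < m (gen b))%N ->
  exists e m1, [/\ e != 0, Q b 'X_[m] = e *: 'X_[m1],
    forall l, l != gen b -> m1 l = m l
    & eps b * (m1 (gen b))%:Z = eps b * (m (gen b))%:Z - 1].
Proof.
rewrite /Qop /eps; case: (tw b) => /= mb.
  exists (-1), (U_(gen b) + m)%MM; split.
  - by rewrite oppr_eq0 oner_eq0.
  - by rewrite scaleN1r mpolyXD.
  - by move=> l lb; rewrite mnmDE mnm1E eq_sym (negPf lb).
  - by rewrite mnmDE mnm1E eqxx; lia.
exists (m (gen b))%:R, (m - U_(gen b))%MM; split.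
- by rewrite natf_eq0 // -lt0n.
- by rewrite mderivX.
- by move=> l lb; rewrite mnmBE mnm1E eq_sym (negPf lb) subn0.
- by rewrite mnmBE mnm1E eqxx; lia.
Qed.

Lemma Pop_X b m : ~~ tw b || (0 < m (gen b))%N ->
  exists e m1, [/\ e != 0, P b 'X_[m] = e *: 'X_[m1],
    forall l, l != gen b -> m1 l = m l
    & eps b * (m1 (gen b))%:Z = eps b * (m (gen b))%:Z + 1].
Proof.
rewrite /Pop /eps; case: (tw b) => /= mb; last first.
  exists 1, (U_(gen b) + m)%MM; split.
  - by rewrite oner_eq0.
  - by rewrite scale1r mpolyXD.
  - by move=> l lb; rewrite mnmDE mnm1E eq_sym (negPf lb).
  - by rewrite mnmDE mnm1E eqxx; lia.
exists (m (gen b))%:R, (m - U_(gen b))%MM; split.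
- by rewrite natf_eq0 // -lt0n.
- by rewrite mderivX.
- by move=> l lb; rewrite mnmBE mnm1E eq_sym (negPf lb) subn0.
- by rewrite mnmBE mnm1E eqxx; lia.
Qed.

Lemma sum0_neg (I : finType) (d : I -> int) :
  \sum_(x : I) d x = 0 -> (exists x, d x != 0) -> exists x, d x < 0.
Proof.
move=> sum0 [x0 dx0]; have [/existsP//|] := boolP [exists x, d x < 0].
rewrite negb_exists => /forallP d_ge0; case/negP: dx0; apply/eqP.
apply: (psumr_eq0P (P := xpredT) (F := d) _ sum0) => // x _.
by rewrite leNgt.
Qed.

Lemma gradeB m m' : gr m' = gr m ->
  \sum_a eps a * ((m' (gen a))%:Z - (m (gen a))%:Z) = 0.
Proof.
move=> mm'; under eq_bigr do rewrite mulrBr.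
by rewrite sumrB -!gradeE mm' subrr.
Qed.

(** Equal grade means that the signed exponent differences d sum to 0, so if m and m' differ, some
    [d b] is negative and some [d a] positive. Then P_a Q_b does not kill m and moves it closer to
    m' in both variables. *)
Lemma connected (U : V -> Prop) m m' : is_subspace U ->
  (forall a b f, U f -> U (P a (Q b f))) ->
  gr m = gr m' -> U 'X_[m] -> U 'X_[m'].
Proof.
move=> sU UPQ.
pose dist m := (\sum_k `|(m k)%:Z - (m' k)%:Z|)%N.
have dist_ltn m1 m2 k : (forall l, l != k -> m1 l = m2 l) ->
    (`|(m1 k)%:Z - (m' k)%:Z| < `|(m2 k)%:Z - (m' k)%:Z|)%N ->
    (dist m1 < dist m2)%N.
  move=> eq12 lt12; rewrite /dist (bigD1 k) //= [X in (_ < X)%N](bigD1 k) //=.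
  rewrite -addSn leq_add //; apply/eqP/eqP.
  by apply: eq_leq; apply: eq_bigr => l /eq12 ->.
move: {2}_.+1 (ltnSn (dist m)) => k; elim: k m => // k IHk m; rewrite ltnS.
move=> distm grm Um.
have [<-//|mm'] := eqVneq m m'.
pose d a := eps a * ((m' (gen a))%:Z - (m (gen a))%:Z).
have eps0 a : eps a != 0 by rewrite /eps; case: ifP.
have d_neq0 : exists a, d a != 0.
  have /existsP[l ml] : [exists l, m l != m' l].
    rewrite -negb_forall; apply: contra mm' => /forallP eqm.
    by apply/eqP/mnmP => l; apply/eqP.
  have [a la] := gen_surj l; exists a; rewrite mulf_neq0 // subr_eq0 -la eq_sym.
  by rewrite eqz_nat.
have sumd : \sum_a d a = 0 by apply: gradeB.
have [b db] := sum0_neg sumd d_neq0.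
have [a da] : exists a, - d a < 0.
  apply: (@sum0_neg _ (fun a => - d a)); first by rewrite sumrN sumd oppr0.
  by case: d_neq0 => a da; exists a; rewrite oppr_eq0.
have ab : gen a != gen b.
  apply/eqP => /gen_inj ab; move: da; rewrite ab oppr_lt0 => /(lt_trans db).
  by rewrite ltxx.
have [c1 [m1 [c10 QX m1E m1b]]] : exists e m1, [/\ e != 0, Q b 'X_[m] = e *: 'X_[m1],
    forall l, l != gen b -> m1 l = m l
    & eps b * (m1 (gen b))%:Z = eps b * (m (gen b))%:Z - 1].
  by apply: Qop_X; move: db; rewrite /d /eps; case: (tw b) => //=; lia.
have [c2 [m2 [c20 PX m2E m2a]]] : exists e m2, [/\ e != 0, P a 'X_[m1] = e *: 'X_[m2],
    forall l, l != gen a -> m2 l = m1 l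
    & eps a * (m2 (gen a))%:Z = eps a * (m1 (gen a))%:Z + 1].
  apply: Pop_X; move: da; rewrite /d /eps (m1E (gen a)) //.
  by case: (tw a) => //=; lia.
apply: (IHk m2); first apply: leq_trans distm.
- apply: (@ltn_trans (dist m1)).
    apply: (dist_ltn _ _ (gen a)) => //; move: m2a da; rewrite (m1E (gen a)) //.
    by rewrite /d /eps; case: (tw a); lia.
  apply: (dist_ltn _ _ (gen b)) => //; move: m1b db.
  by rewrite /d /eps; case: (tw b); lia.
- rewrite -grm !gradeE (bigD1 a) //= (bigD1 b) /=; last first.
    by apply: contra ab => /eqP ->.
  rewrite [RHS](bigD1 a) //= [X in _ = _ + X](bigD1 b) /=; last first.
    by apply: contra ab => /eqP ->.
  rewrite m2a (m1E (gen a)) // (m2E (gen b)) 1?eq_sym // m1b.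
  rewrite [X in _ + (_ + X)](eq_bigr (fun c => eps c * (m (gen c))%:Z)).
    by ring.
  move=> c /andP[ca cb].
  have gen_neq (x y : A) : x != y -> gen x != gen y.
    by apply: contra => /eqP/gen_inj ->.
  by rewrite m2E ?m1E ?gen_neq.
- have UX := UPQ a b _ Um; rewrite QX PopZ PX scalerA in UX.
  by apply: subspaceZK UX => //; rewrite mulf_neq0.
Qed.

Lemma B_part_PQ_irr k (U : V -> Prop) : is_subspace U ->
  (forall a b f, U f -> U (P a (Q b f))) -> (forall f, U f -> Bk k f) ->
  (exists2 f, U f & f != 0) -> forall f, Bk k f -> U f.
Proof.
move=> sU UPQ UB [f0 Uf0 f00].
have [g [Ug g0 gT]] := diag_exists mcoeff_PQ sU (fun a f => UPQ a a f) Uf0 f00.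
have [m mg] := msupp_neq0 g0.
(* The weights of all P_a Q_a determine every exponent, so a common eigenvector is a multiple of one
   monomial. *)
have Um : U 'X_[m].
  have gm : g@_m != 0 by rewrite -mcoeff_msupp.
  have gX : g = g@_m *: 'X_[m].
    rewrite {1}[g]mpolyE (bigD1_seq m) ?msupp_uniq //= big_seq_cond.
    rewrite big1 ?addr0 // => p /andP[pg /eqP pm]; case: pm.
    apply/mnmP => l; have [a ->] := gen_surj l.
    have := gT _ a pg; rewrite (gT _ a mg) => /eqP.
    rewrite -subr_eq0 -scalerBl scaler_eq0 (negPf g0) orbF subr_eq0.
    move/eqP/(intf_inj charF); rewrite /weight /eps; case: (tw a); lia.
  by rewrite gX in Ug; apply: subspaceZK Ug.
move=> f /B_partP Hf; rewrite [f]mpolyE; apply: subspace_sum_seq => // p pf.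
apply: subspaceZ => //; apply: (connected sU UPQ) Um.
by rewrite (Hf _ pf); move/UB/B_partP: Ug => /(_ _ mg).
Qed.

Lemma B_part_X k m : gr m = k -> Bk k 'X_[m].
Proof. by move=> mk; apply: lin_span_mem; exists m. Qed.

End Grading.

(** * Irreducibility over sp(2n) *)

Section Irreducible.
Context (F : fieldType) (charF : [pchar F] =i pred0) (n n1 n2 : nat).
Notation V := {mpoly F[n + n]}.
Notation A := (bool * 'I_n)%type.
Notation P := (@Pop F n n1 n2).
Notation Q := (@Qop F n n1 n2).
Notation R := (@Rop F n n1 n2).
Notation S := (@Sop F n n1 n2).
Notation T := (@Top F n n1 n2).
Notation tw := (@twisted n n1 n2).
Notation gr := (@grade n n1 n2).
Notation Bk := (@B_part F n n1 n2).
Notation om := (@om F n).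
Implicit Types (a b c d : A) (f g : V) (i j : 'I_n) (m : 'X_{1..n + n}).

Lemma Top_linear a b k f g : T a b (k *: f + g) = k *: T a b f + T a b g.
Proof.
by rewrite /Top !(PopD, RopD, PopZ, RopZ) -!mul_mpolyC; ring.
Qed.

Lemma Sop_linear a b k f g : S a b (k *: f + g) = k *: S a b f + S a b g.
Proof.
by rewrite /Sop !(PopD, RopD, PopZ, RopZ) -!mul_mpolyC; ring.
Qed.

Lemma Top0 a b : T a b 0 = 0.
Proof. by have := Top_linear a b (-1) 0 0; rewrite scaler0 addr0 scaleN1r addNr. Qed.

Lemma TopD a b f g : T a b (f + g) = T a b f + T a b g.
Proof. by have := Top_linear a b 1 f g; rewrite !scale1r. Qed.

Lemma TopZ a b k f : T a b (k *: f) = k *: T a b f.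
Proof. by rewrite -[k *: f]addr0 Top_linear Top0 addr0. Qed.

Section Stable.
Context (U : V -> Prop) (sU : is_subspace U).
Hypothesis US : forall a b f, U f -> U (S a b f).

Lemma Top_Top_stable a b c d f : U f -> U (T a b (T c d f)).
Proof.
move=> Uf; have USS a' b' c' d' : U (S a' b' (S c' d' f)) by apply: US; apply: US.
have UZ k a' b' : U (k *: S a' b' f) by apply: subspaceZ => //; apply: US.
rewrite Top_Top; apply: (subspaceD sU); last by do 2![apply: subspaceZ => //].
do 2![apply: (subspaceD sU); last exact: UZ].
by apply: (subspaceB sU); [apply: (subspaceB sU) | apply: UZ].
Qed.

Lemma T_diag i f : T (true, i) (false, i) f =
  - (P (true, i) (Q (true, i) f) + P (false, i) (Q (false, i) f) + f).
Proof.
rewrite /Top /Rop /= PopN /om eqxx mul1r subr0 scale1r.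
by rewrite !opprD.
Qed.

Lemma mcoeff_T_diag i f m : (T (true, i) (false, i) f)@_m =
  (- (weight n1 n2 (true, i) m + weight n1 n2 (false, i) m + 1))%:~R * f@_m.
Proof.
rewrite T_diag mcoeffN !mcoeffD !mcoeff_PQ !(intrN, intrD) mulNr.
by rewrite !mulrDl mul1r.
Qed.

(* The square of the skew operator lies in the algebra generated by the S, and
   the operator itself has only positive weights when x_i and y_i are
   untwisted, hence is invertible on the eigenspaces of its square. *)
Lemma T_stable_untwisted i : ~~ tw (true, i) -> ~~ tw (false, i) ->
  forall a b f, U f -> U (T a b f).
Proof.
move=> twx twy a b f Uf; pose e := T (true, i) (false, i).
pose w m : int := (m (gen (true, i)) + m (gen (false, i)) + 1)%N.
have eE g m : (e g)@_m = (- w m)%:~R * g@_m.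
  rewrite mcoeff_T_diag /weight /eps (negPf twx) (negPf twy).
  by congr (_%:~R * _); rewrite /w; lia.
(* The preimage of U under e contains [T a b f], since products of two skew operators preserve U. It
   remains to see that [U'] lies in U, which is checked on eigenvectors of e^2: [w] is positive, so
   its square determines it and e acts there by a nonzero scalar. *)
pose U' g := U (e g).
have sU' : is_subspace U'.
  split; first by rewrite /U' /e Top0; case: sU.
  by move=> k g h Ug Uh; rewrite /U' /e Top_linear; apply: (proj2 sU).
have eeE (_ : unit) g m : (e (e g))@_m = (w m ^+ 2)%:~R * g@_m.
  by rewrite !eE mulrA -intrM mulrNN.
apply: (diag_ind eeE sU' sU) (Top_Top_stable _ _ _ _ Uf).
  by move=> _ g Ug; rewrite /U' /e; apply: Top_Top_stable.
move=> g Ug g0 gE; have [m mg] := msupp_neq0 g0.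
have eg : e g = (- w m)%:~R *: g.
  apply/mpolyP => p; rewrite eE mcoeffZ.
  have [pg|/memN_msupp_eq0 ->] := boolP (p \in msupp g); last by rewrite !mulr0.
  have := gE _ tt pg; rewrite (gE _ tt mg) => /eqP.
  rewrite -subr_eq0 -scalerBl scaler_eq0 (negPf g0) orbF subr_eq0.
  by move/eqP/(intf_inj charF)/eqP; rewrite eqrXn2 // => /eqP ->.
move: Ug; rewrite /U' eg; apply: subspaceZK => //.
by rewrite intf_eq0 // oppr_eq0 /w addn1.
Qed.

End Stable.

Lemma sp_irreducible_of_T k : (exists2 f, Bk k f & f != 0) ->
  (forall U : V -> Prop, is_subspace U -> (forall f, U f -> Bk k f) ->
     (forall a b f, U f -> U (S a b f)) -> forall a b f, U f -> U (T a b f)) ->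
  sp_irreducible n1 n2 (Bk k).
Proof.
move=> [f0 Bf0 f00] stab; split.
- by apply/sp_submoduleP => //; split; [apply: B_part_subspace|move=> *; apply: B_part_S].
- by exists f0 => //; apply/eqP.
- move=> U /sp_submoduleP[//|sU US] UB.
  have UPQ := PQ_stable charF sU US (stab U sU UB US).
  have [[f Uf f_neq0]|none] := classic (exists2 f, U f & f != 0).
    by right; apply: (B_part_PQ_irr charF sU UPQ UB); exists f.
  left=> f Uf; apply/eqP/negPn/negP => f_neq0; apply: none.
  by exists f.
Qed.

Lemma grade_Xn a (e : nat) : gr (U_(gen a) *+ e)%MM = eps n1 n2 a * e%:Z.
Proof.
rewrite gradeE (bigD1 a) //= mulmnE mnm1E eqxx mul1n big1 ?addr0 // => b ba.
rewrite mulmnE mnm1E; case: eqP => [/gen_inj ab|_]; last by rewrite mul0n mulr0.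
by rewrite ab eqxx in ba.
Qed.

Lemma B_part_neq0 k : (0 < n1)%N -> (n1 <= n2)%N -> (n2 <= n)%N ->
  exists2 f, Bk k f & f != 0.
Proof.
move=> n1_gt0 n12 n2n.
have n_gt0 : (0 < n)%N by apply: leq_trans n1_gt0 (leq_trans n12 n2n).
have n2_gt0 := leq_trans n1_gt0 n12.
(* The witness is a power of the first x, of grade -1, for negative k, and of the first y, of grade
   1, otherwise. *)
pose a : A := ((k < 0), Ordinal n_gt0).
exists 'X_[U_(gen a) *+ `|k|%N]; last by rewrite -msupp_eq0 msuppX.
apply: B_part_X; rewrite grade_Xn /eps /twisted /a {a} /=.
case: k => k /=; first by rewrite leqNgt n2_gt0 mul1r.
by rewrite n1_gt0 NegzE mulN1r.
Qed.

Lemma sp_irreducible_lt k : (0 < n1)%N -> (n1 < n2)%N -> (n2 <= n)%N ->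
  sp_irreducible n1 n2 (Bk k).
Proof.
move=> n1_gt0 n12 n2n; apply: sp_irreducible_of_T.
  by apply: B_part_neq0 => //; apply: ltnW.
move=> U sU UB US; apply: (T_stable_untwisted sU US (i := Ordinal (leq_trans n12 n2n))).
  by rewrite /twisted /= ltnn.
by rewrite /twisted /= -ltnNge.
Qed.

End Irreducible.

(** * The case n1 = n2 with k nonzero *)

Section EqualCase.
Context (F : fieldType) (charF : [pchar F] =i pred0) (n n1 : nat).
Notation V := {mpoly F[n + n]}.
Notation A := (bool * 'I_n)%type.
Notation P := (@Pop F n n1 n1).
Notation Q := (@Qop F n n1 n1).
Notation R := (@Rop F n n1 n1).
Notation T := (@Top F n n1 n1).
Notation tw := (@twisted n n1 n1).
Notation Bk := (@B_part F n n1 n1).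
Notation om := (@om F n).
Notation eul := (@euler F n n1 n1).
Implicit Types (a b c d : A) (f g : V) (i j : 'I_n) (m : 'X_{1..n + n}).

(** For n1 = n2 exactly one of x_i and y_i is twisted, so the correction terms of the Euler operator
    add up to the constant 1 in [T_diag] for each i. *)
Lemma euler_T f : eul f = - \sum_i T (true, i) (false, i) f.
Proof.
rewrite /euler -(pair_bigA _ (fun t i => P (t, i) (Q (t, i) f) + (tw (t, i))%:R *: f)) /=.
rewrite big_bool /= -big_split -sumrN; apply: eq_bigr => i _ /=.
rewrite T_diag opprK /twisted /= leqNgt addrACA -scalerDl -natrD.
by rewrite addn_negb scale1r.
Qed.

Lemma sp_irreducible_eq k : (0 < n1)%N -> (n1 <= n)%N -> k <> 0 ->
  sp_irreducible n1 n1 (Bk k).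
Proof.
move=> n1_gt0 n1n k0; apply: sp_irreducible_of_T => //.
  exact: B_part_neq0.
move=> U sU UB US a b f Uf.
have kF : (k%:~R : F) != 0 by rewrite intf_eq0 //; apply/eqP.
(* On B_k, k times T_ab f equals the Euler operator applied to T_ab f, a sum of products of two skew
   operators applied to f. *)
apply: (subspaceZK sU kF).
have /(B_part_euler charF) <- : Bk k (T a b f).
  by apply: (B_part_T charF); apply: UB.
rewrite euler_T; apply: subspaceN => //; apply: subspace_sum => // i _.
exact: Top_Top_stable.
Qed.

End EqualCase.

(** * The reflection for n1 = n2 and the two halves of B_0 *)

Lemma mpoly_ring_ind (F : fieldType) N (K : {mpoly F[N]} -> Prop) :
  (forall c, K c%:MP) -> (forall l, K 'X_l) ->
  (forall f g, K f -> K g -> K (f + g)) ->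
  (forall f g, K f -> K g -> K (f * g)) -> forall f, K f.
Proof.
move=> KC KX KD KM f; rewrite [f]mpolyE.
apply: (big_ind K) => // [|m _]; first by rewrite -mpolyC0.
rewrite -mul_mpolyC; apply: (KM) => //; rewrite mpolyXE_id.
apply: (big_ind K) => // [|l _]; first by rewrite -mpolyC1.
elim: (m l) => [|e IHe]; first by rewrite expr0 -mpolyC1.
by rewrite exprS; apply: KM.
Qed.

Section Reflection.
Context (F : fieldType) (charF : [pchar F] =i pred0) (n n1 : nat).
Notation V := {mpoly F[n + n]}.
Notation A := (bool * 'I_n)%type.
Notation P := (@Pop F n n1 n1).
Notation R := (@Rop F n n1 n1).
Notation S := (@Sop F n n1 n1).
Notation T := (@Top F n n1 n1).
Notation tw := (@twisted n n1 n1).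
Notation Bk := (@B_part F n n1 n1).
Notation om := (@om F n).
Implicit Types (a b c d : A) (f g : V) (i j : 'I_n) (m : 'X_{1..n + n}).

Local Arguments gen {n} a : simpl never.

Definition bar a : A := (~~ a.1, a.2).
Definition sgn a : F := if (a.2 < n1)%N then 1 else -1.

(* The signs are chosen so that the substitution exchanges the P and the R. *)
Definition reflection_image (l : 'I_(n + n)) : V :=
  match split l with
  | inl i => sgn (true, i) *: 'X_(gen (false, i))
  | inr i => sgn (false, i) *: 'X_(gen (true, i))
  end.

Definition reflection f : V := f \mPo [tuple reflection_image l | l < n + n].
Notation sig := reflection.

HB.instance Definition _ := GRing.RMorphism.copy sig
  (comp_mpoly [tuple reflection_image l | l < n + n]).

Lemma reflectionZ k f : sig (k *: f) = k *: sig f.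
Proof. exact: comp_mpolyZ. Qed.

Lemma barK : involutive bar.
Proof. by move=> [t i]; rewrite /bar /= negbK. Qed.

Lemma sgn_bar a : sgn (bar a) = sgn a.
Proof. by []. Qed.

Lemma sgnM a : sgn a * sgn a = 1.
Proof. by rewrite /sgn; case: ifP => _; rewrite ?mulr1 // mulrNN mulr1. Qed.

Lemma reflectionX a : sig 'X_(gen a) = sgn a *: 'X_(gen (bar a)).
Proof.
rewrite /sig comp_mpolyXU -tnth_nth tnth_mktuple /reflection_image.
case: a => [[] i]; rewrite [gen _]/gen /=.
  by case: splitP => j /= ij; [rewrite (val_inj ij)|have := ltn_ord i; lia].
case: splitP => j /= ij; first by have := ltn_ord j; lia.
by have -> : i = j by apply: val_inj; move: ij => /= /addnI.
Qed.

Lemma reflectionK : involutive sig.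
Proof.
apply: mpoly_ring_ind => [c|l|f g Hf Hg|f g Hf Hg].
- by rewrite /sig !comp_mpolyC.
- have [a ->] := gen_surj l.
  by rewrite reflectionX reflectionZ reflectionX scalerA sgn_bar sgnM scale1r barK.
- by rewrite !rmorphD /= Hf Hg.
- by rewrite !rmorphM /= Hf Hg.
Qed.

Lemma reflection_deriv a f :
  sig f^`M(gen a) = sgn a *: (sig f)^`M(gen (bar a)).
Proof.
move: f; apply: mpoly_ring_ind => [c|l|f g Hf Hg|f g Hf Hg].
- by rewrite /sig comp_mpolyC !mderivC scaler0 comp_mpoly0.
- have [b ->] := gen_surj l.
  rewrite reflectionX mderivZ !mderiv_gen (inj_eq (can_inj barK)) scalerA.
  rewrite /sig comp_mpolyC; case: eqP => [->|_]; last by rewrite mpolyC0 scaler0.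
  by rewrite sgnM scale1r.
- by rewrite mderivD !rmorphD mderivD scalerDr /= Hf Hg.
- by rewrite mderivM rmorphD !rmorphM mderivM scalerDr /= Hf Hg scalerAl scalerAr.
Qed.

(** The partner of a twisted variable is untwisted because n1 = n2, so exchanging x_i and y_i turns
    a derivative P into a derivative R, and likewise for multiplications. *)
Lemma reflection_P a f : sig (P a f) = R a (sig f).
Proof.
case: a => [[] i]; rewrite /Rop /Pop /Qop /twisted /= [(n1 <= _)%N]leqNgt;
  have := reflection_deriv (_, i) f; have := reflectionX (_, i);
  rewrite /sgn /bar /=; case: (i < n1)%N => /= sX sD.
- by rewrite (sD true) scale1r.
- by rewrite rmorphM /= (sX true) scaleN1r mulNr.
- by rewrite rmorphM /= (sX false) scale1r opprK.
- by rewrite (sD false) scaleN1r.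
Qed.

Lemma reflection_R a f : sig (R a f) = P a (sig f).
Proof.
by rewrite -{1}[f]reflectionK -reflection_P reflectionK.
Qed.

(** The reflection turns P_a R_b into R_a P_b, which is P_b R_a plus the scalar [om a b]. In the
    symmetric sum these scalars cancel; in the skew combination the whole operator changes sign. *)
Lemma reflection_S a b f : sig (S a b f) = S a b (sig f).
Proof.
rewrite /Sop rmorphD /= !reflection_P !reflection_R !RopP (omZC a b).
by rewrite -!mul_mpolyC; ring.
Qed.

Lemma reflection_T a b f : sig (T a b f) = - T a b (sig f).
Proof.
rewrite /Top !rmorphB /= reflectionZ !reflection_P !reflection_R !RopP (omZC a b).
by rewrite -!mul_mpolyC; ring.
Qed.

(** The Euler operator is a sum of skew operators, hence anticommutes with the reflection, and its
    kernel is preserved. *)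
Lemma reflection_B0 f : Bk 0 f -> Bk 0 (sig f).
Proof.
rewrite !B_part_euler // !scale0r => Ef.
have : sig (euler n1 n1 f) = 0 by rewrite Ef rmorph0.
rewrite !euler_T rmorphN rmorph_sum /= (eq_bigr (fun i => - T (true, i) (false, i) (sig f))).
  by rewrite sumrN opprK => ->; rewrite oppr0.
by move=> i _; rewrite reflection_T.
Qed.

Definition B0_half (e : bool) f : Prop := Bk 0 f /\ sig f = (-1) ^+ e *: f.

Lemma B0_half_subspace e : is_subspace (B0_half e).
Proof.
have sB : is_subspace (Bk 0) by apply: B_part_subspace.
split; first by split; [case: sB | rewrite rmorph0 scaler0].
move=> k f g [Bf sf] [Bg sg]; split; first exact: (proj2 sB).
by rewrite rmorphD /= reflectionZ sf sg !scalerDr !scalerA mulrC.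
Qed.

Lemma B0_half_S e a b f : B0_half e f -> B0_half e (S a b f).
Proof.
move=> [Bf sf]; split; first exact: B_part_S.
by rewrite reflection_S sf -[_ *: f]addr0 Sop_linear /Sop !linear0 !addr0.
Qed.

Lemma B0_half_T e a b f : B0_half e f -> B0_half (~~ e) (T a b f).
Proof.
move=> [Bf sf]; split; first exact: B_part_T.
by rewrite reflection_T sf TopZ -scaleNr; case: e {sf}; rewrite !expr0 ?expr1 ?opprK.
Qed.

Lemma signf_inj : injective (fun e : bool => (-1) ^+ e : F).
Proof.
have two : (1 == -1 :> F) = false.
  by rewrite -subr_eq0 opprK -[1 + 1]/(2%:R) natf_eq0.
by move=> [] [] //= /eqP; rewrite expr1 expr0 ?two // eq_sym two.
Qed.

Lemma B0_half_disjoint e f : B0_half e f -> B0_half (~~ e) f -> f = 0.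
Proof.
move=> [_ sf] [_]; rewrite sf => /eqP; rewrite -subr_eq0 -scalerBl scaler_eq0.
by case/orP=> [|/eqP //]; rewrite subr_eq0 => /eqP/signf_inj; case: (e).
Qed.

Lemma B0_half_sum : is_direct_sum (Bk 0) B0_half.
Proof.
have sB : is_subspace (Bk 0) by apply: B_part_subspace.
split.
- by move=> e f [].
- move=> f Bf; exists [:: false; true], (fun e : bool => 2%:R^-1 *: (f + (-1) ^+ e *: sig f)).
  have two0 := two_neq0 charF.
  split=> // [e|].
    split.
      by apply: subspaceZ => //; apply: subspaceD => //; apply: subspaceZ => //; apply: reflection_B0.
    rewrite reflectionZ rmorphD /= reflectionZ reflectionK.
    rewrite [RHS]scalerA mulrC -scalerA; congr (_ *: _).
    by rewrite scalerDr scalerA -signr_addb addbb scale1r addrC.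
  rewrite big_cons big_seq1 expr0 expr1 scale1r scaleN1r -scalerDr.
  by rewrite addrACA subrr addr0 -mulr2n -scaler_nat scalerA mulVf // scale1r.
- move=> s u us Uu sum0; apply: (@eigenvectors_free F V bool unit (fun _ => sig)
    (fun _ e => (-1) ^+ e) s) sum0 => //.
  + by move=> _ k f g; rewrite rmorphD /= reflectionZ.
  + move=> e e' _ _ ee'; exists tt.
    by apply: contra ee' => /eqP/signf_inj ->.
  + by move=> e _; case: (Uu e).
Qed.

(* If U is a submodule of one half, then U + T U is stable under all P_a Q_b,
   hence is B_0, and T U lies in the other half. *)
Lemma B0_half_irr e : (1 < n)%N -> (0 < n1)%N -> (n1 <= n)%N ->
  (exists2 f, B0_half e f & f != 0) -> sp_irreducible n1 n1 (B0_half e).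
Proof.
move=> n_gt1 n1_gt0 n1n [f0 Wf0 f00]; split.
- by apply/sp_submoduleP => //; split; [apply: B0_half_subspace|move=> *; apply: B0_half_S].
- by exists f0 => //; apply/eqP.
move=> U /sp_submoduleP[//|sU US] UW.
have [[f1 Uf1 f10]|none] := classic (exists2 f, U f & f != 0); last first.
  left=> f Uf; apply/eqP/negPn/negP => f_neq0; apply: none.
  by exists f.
right=> f Wf; pose X := lin_span (fun g => exists a b, exists2 u, U u & g = T a b u).
have sX : is_subspace X by apply: lin_span_subspace.
have XT a b u : U u -> X (T a b u).
  by move=> Uu; apply: lin_span_mem; exists a, b, u.
have XS a b g : X g -> X (S a b g).
  apply: (@lin_span_min _ _ _ (fun g => X (S a b g))).
    split; first by rewrite /Sop !linear0 addr0; case: sX.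
    by move=> k x y Xx Xy; rewrite Sop_linear; apply: (proj2 sX).
  move=> _ [c [d [u Uu ->]]]; rewrite Sop_Top.
  do 4![apply: (subspaceD sX); last by apply: (subspaceZ _ sX); apply: XT].
  by apply: XT; apply: US.
have TX a b g : X g -> U (T a b g).
  apply: (@lin_span_min _ _ _ (fun g => U (T a b g))).
    split; first by rewrite Top0; case: sU.
    by move=> k x y Xx Xy; rewrite Top_linear; apply: (proj2 sU).
  by move=> _ [c [d [u Uu ->]]]; apply: Top_Top_stable.
have XW g : X g -> B0_half (~~ e) g.
  apply: lin_span_min; first exact: B0_half_subspace.
  by move=> _ [c [d [u Uu ->]]]; apply: B0_half_T; apply: UW.
pose Y g := exists u w, [/\ U u, X w & g = u + w].
have sY : is_subspace Y.
  split; first by exists 0, 0; rewrite addr0; split=> //; [case: sU|case: sX].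
  move=> k _ _ [u [w [Uu Xw ->]]] [u' [w' [Uu' Xw' ->]]].
  exists (k *: u + u'), (k *: w + w'); split.
  - exact: (proj2 sU).
  - exact: (proj2 sX).
  - by rewrite scalerDr addrACA.
have YS a b g : Y g -> Y (S a b g).
  move=> [u [w [Uu Xw ->]]]; exists (S a b u), (S a b w).
  by rewrite -[u]scale1r Sop_linear !scale1r; split=> //; [apply: US|apply: XS].
have YT a b g : Y g -> Y (T a b g).
  move=> [u [w [Uu Xw ->]]]; exists (T a b w), (T a b u).
  by rewrite TopD addrC; split=> //; [apply: TX|apply: XT].
have YPQ := PQ_stable charF sY YS YT.
have UY u : U u -> Y u.
  by move=> Uu; exists u, 0; rewrite addr0; split=> //; case: sX.
have YB g : Y g -> Bk 0 g.
  move=> [u [w [/UW [Bu _] /XW [Bw _] ->]]].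
  by apply: subspaceD => //; apply: B_part_subspace.
have := B_part_PQ_irr charF sY YPQ YB; case/(_ _ f).
- by exists f1; [apply: UY|].
- by case: Wf.
move=> u [w [Uu Xw fuw]]; suff w0 : w = 0 by rewrite fuw w0 addr0.
apply: (@B0_half_disjoint e); last exact: XW.
have -> : w = f - u by rewrite fuw addrAC subrr add0r.
by apply: subspaceB => //; [apply: B0_half_subspace | apply: UW].
Qed.

Lemma B0_half_neq0 e : (1 < n)%N -> (0 < n1)%N -> (n1 <= n)%N ->
  exists2 f, B0_half e f & f != 0.
Proof.
move=> n_gt1 n1_gt0 n1n.
have W1 : B0_half false 1.
  split; last by rewrite rmorph1 scale1r.
  rewrite -mpolyX0; apply: B_part_X; rewrite gradeE big1 // => a _.
  by rewrite mnm0E mulr0.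
case: e; last by exists 1; rewrite ?oner_eq0.
pose i0 : 'I_n := Ordinal (ltnW n_gt1); pose i1 : 'I_n := Ordinal n_gt1.
(* The untwisted one of the second pair of variables, so that [P b] is a multiplication. The skew
   operator applied to 1 then is a difference of two distinct quadratic monomials up to signs; two
   different indices are needed, whence n > 1. *)
pose b : A := ((n1 <= 1)%N, i1).
exists (T (false, i0) b 1); first exact: (@B0_half_T false).
have twE t i : tw (t, i) = (t == (i < n1)%N).
  by rewrite /twisted /=; case: t; [case: ltnP | case: ltnP].
suff : (T (false, i0) b 1)@_(U_(gen (true, i0)) + U_(gen b)) != 0.
  by apply: contraNneq => ->; rewrite mcoeff0.
have -> : T (false, i0) b 1 =
    (-1) ^+ (n1 <= 1)%N *: ('X_(gen (false, i0)) * 'X_(gen (bar b)))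
    - 'X_(gen (true, i0)) * 'X_(gen b).
  rewrite /Top /om /= mul0r scale0r subr0 /Rop /= /Qop /Pop !twE /bar /b /=.
  rewrite n1_gt0 [(1 < n1)%N]ltnNge; case: (n1 <= 1)%N; rewrite /= !mulr1 !opprK.
    by rewrite scaleN1r mulrN [X in _ - X]mulrC.
  by rewrite scale1r [X in _ - X]mulrC.
rewrite mcoeffB mcoeffZ -!mpolyXD !mcoeffX eqxx.
rewrite (negPf (_ : _ != (_ + _)%MM)) ?mulr0 ?sub0r ?oppr_eq0 ?oner_eq0 //.
apply/eqP => /mnmP eqm; have := eqm (gen (true, i0)).
by rewrite !mnmDE !mnm1E !(inj_eq (@gen_inj n)) eqxx /bar /b /= !xpair_eqE /= !andbF.
Qed.

End Reflection.

(** * Highest-weight type and infinite dimension *)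

Section Types.
Context (F : fieldType) (charF : [pchar F] =i pred0) (n n1 n2 : nat).
Notation V := {mpoly F[n + n]}.
Implicit Types (f g : V).

Lemma mpolyX_neq0 m : ('X_[m] : V) != 0.
Proof. by rewrite -msupp_eq0 msuppX. Qed.

Lemma highest_weight_eq (W : V -> Prop) : (0 < n)%N -> (n1 <= n2)%N ->
  (n2 <= n)%N -> highest_weight_type n1 n2 W -> n2 = n.
Proof.
move=> n_gt0 n12; rewrite leq_eqVlt => /predU1P[//|n2n] [v [[_ v0] _ pos _]].
have last_lt : (n.-1 < n)%N by rewrite prednK.
pose i := Ordinal last_lt.
have n2i : (n2 <= n.-1)%N by rewrite -ltnS prednK.
have n1i := leq_trans n12 n2i.
have : sp_act n1 n2 (E_up F i i) v = 0 by apply: pos; right; exists i.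
rewrite sp_act_E_up_diag /Exy /= ltnNge n1i ltnNge n2i /= => /eqP.
by rewrite oppr_eq0 !mulf_eq0 !(negPf (mpolyX_neq0 _)) /= => /eqP.
Qed.

(** Multiplication by x_1 y_1 belongs to the action up to sign, since n1 and n2 are positive. It is
    injective and raises the degree, whereas a finite spanning family bounds the degree. *)
Lemma not_fin_dim (W : V -> Prop) : (0 < n)%N -> (0 < n1)%N -> (0 < n2)%N ->
  sp_irreducible n1 n2 W -> ~ fin_dim W.
Proof.
move=> n_gt0 n1_gt0 n2_gt0 [[sW Wact] [f0 Wf0 /eqP f00] _] [s [sWs Ws]].
pose i := Ordinal n_gt0.
have large k : exists f, [/\ W f, f != 0 & (k <= msize f)%N].
  elim: k => [|k [f [Wf f_neq0 kf]]]; first by exists f0.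
  pose x : V := xvar F i * yvar F i.
  have x0 : x != 0 by rewrite mulf_neq0 ?mpolyX_neq0.
  exists (x * f); split; last first.
  - rewrite msizeM // /x msizeM ?mpolyX_neq0 // !msizeX !mdeg1 /=.
    by rewrite addSn ltnS; apply: leq_trans kf (leq_addl _ _).
  - by rewrite mulf_neq0.
  have -> : x * f = - sp_act n1 n2 (E_low F i i) f.
    by rewrite sp_act_E_low_diag /Eyx /= n1_gt0 n2_gt0 opprK.
  apply: subspaceN => //; apply: Wact => //.
  have := memvZ 2%:R^-1 (E_low_sp F i i); rewrite -mulr2n -scaler_nat scalerA.
  by rewrite mulVf ?two_neq0 // scale1r.
pose M := (\max_(v <- s) msize v)%N.
have WM f : W f -> (msize f <= M)%N.
  move/Ws; move: f; apply: lin_span_min; first split.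
  - by rewrite msize0.
  - move=> a u v uM vM; apply: leq_trans (msizeD_le _ _) _.
    by rewrite geq_max vM (leq_trans (msizeZ_le _ _) uM).
  - by move=> u us; apply: leq_bigmax_seq.
have [f [Wf _]] := large M.+1.
by rewrite ltnNge WM.
Qed.

End Types.

(** * Derivations of polynomial rings *)

Section Derivations.
Context (F : fieldType) (N : nat).
Notation V := {mpoly F[N]}.

Definition derivation (D : V -> V) : Prop :=
  (forall k f g, D (k *: f + g) = k *: D f + D g) /\
  (forall f g, D (f * g) = D f * g + f * D g).

Section Basics.
Context (D : V -> V) (dD : derivation D).

Lemma derivation0 : D 0 = 0.
Proof. by have := dD.1 (-1) 0 0; rewrite scaler0 addr0 scaleN1r addNr. Qed.

Lemma derivationD f g : D (f + g) = D f + D g.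
Proof. by have := dD.1 1 f g; rewrite !scale1r. Qed.

Lemma derivationZ k f : D (k *: f) = k *: D f.
Proof. by have := dD.1 k f 0; rewrite derivation0 !addr0. Qed.

Lemma derivationB f g : D (f - g) = D f - D g.
Proof. by rewrite -scaleN1r derivationD derivationZ scaleN1r. Qed.

Lemma derivationC c : D c%:MP = 0.
Proof.
have D1 : D 1 = 0.
  by have := dD.2 1 1; rewrite !mulr1 mul1r => /eqP; rewrite -subr_eq0 opprD addNKr oppr_eq0 => /eqP.
by rewrite -[c%:MP]mulr1 mul_mpolyC derivationZ D1 scaler0.
Qed.

Lemma derivationX_eigen f mu k : D f = mu *: f -> D (f ^+ k) = (k%:R * mu) *: f ^+ k.
Proof.
move=> Df; elim: k => [|k IHk]; first by rewrite expr0 mul0r scale0r -mpolyC1 derivationC.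
by rewrite exprS dD.2 Df IHk -scalerAr -scalerAl -scalerDl -nat1r mulrDl mul1r.
Qed.

End Basics.

Lemma derivation_ext D D' : derivation D -> derivation D' ->
  (forall l, D 'X_l = D' 'X_l) -> forall f, D f = D' f.
Proof.
move=> dD dD' DX; apply: mpoly_ring_ind => // [c|f g Hf Hg|f g Hf Hg].
- by rewrite (derivationC dD) (derivationC dD').
- by rewrite (derivationD dD) (derivationD dD') Hf Hg.
- by rewrite dD.2 dD'.2 Hf Hg.
Qed.

Lemma derivation_comm D D' : derivation D -> derivation D' ->
  derivation (fun f => D (D' f) - D' (D f)).
Proof.
move=> dD dD'; split=> [k f g|f g].
  by rewrite dD'.1 dD.1 dD.1 dD'.1 -!mul_mpolyC; ring.
by rewrite dD'.2 dD.2 (derivationD dD) (derivationD dD') !dD.2 !dD'.2; ring.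
Qed.

Lemma derivation_lin D D' c c' : derivation D -> derivation D' ->
  derivation (fun f => c *: D f - c' *: D' f).
Proof.
move=> dD dD'; split=> [k f g|f g].
  by rewrite dD.1 dD'.1 -!mul_mpolyC; ring.
by rewrite dD.2 dD'.2 -!mul_mpolyC; ring.
Qed.

Lemma derivation_zero : derivation (fun=> 0).
Proof. by split=> [k f g|f g]; rewrite ?scaler0 ?addr0 // mul0r mulr0 addr0. Qed.

Lemma derivation_bigsum (I : finType) (u : I -> V) (l : I -> 'I_N) :
  derivation (fun f => \sum_i u i * f^`M(l i)).
Proof.
split=> [k f g|f g].
  rewrite scaler_sumr -big_split; apply: eq_bigr => i _ /=.
  by rewrite linearP mulrDr scalerAr.
rewrite mulr_suml mulr_sumr -big_split; apply: eq_bigr => i _ /=.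
by rewrite mderivM; ring.
Qed.

End Derivations.

(** * Decomposition over gl(n) *)

Section HoweOperators.
Context (F : fieldType) (charF : [pchar F] =i pred0) (n : nat).
Notation V := {mpoly F[n + n]}.
Implicit Types (t u : bool) (f g w : V) (i j k l : 'I_n) (m : 'X_{1..n + n}).

Definition var t i : V := 'X_(gen (t, i)).
Definition der t i f : V := f^`M(gen (t, i)).

(* F_tu and G_ij span commuting copies of gl_2 and gl_n. *)
Definition Fop t u f : V := \sum_i var t i * der u i f.
Definition Gop i j f : V := \sum_t var t i * der t j f.

Lemma der_var t u i j : der t i (var u j) = ((t == u) && (i == j))%:R%:MP.
Proof. by rewrite /der /var mderiv_gen. Qed.

Lemma der_varM t u i j f :
  der t i (var u j * f) = var u j * der t i f + ((t == u) && (i == j))%:R *: f.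
Proof. exact: mderiv_genM. Qed.

Lemma Fop_der t u : derivation (Fop t u).
Proof. exact: derivation_bigsum. Qed.

Lemma Gop_der i j : derivation (Gop i j).
Proof. exact: derivation_bigsum. Qed.

Lemma FopX t u v k : Fop t u (var v k) = (u == v)%:R *: var t k.
Proof.
rewrite /Fop (bigD1 k) //= big1 => [|i /negPf ik].
  by rewrite der_var eqxx andbT mulrC mul_mpolyC addr0.
by rewrite der_var ik andbF mpolyC0 mulr0.
Qed.

Lemma GopX i j t k : Gop i j (var t k) = (j == k)%:R *: var t i.
Proof.
rewrite /Gop (bigD1 t) //= big1 => [|u /negPf ut].
  by rewrite der_var eqxx mulrC mul_mpolyC addr0.
by rewrite der_var ut mpolyC0 mulr0.
Qed.

(** Commutators of derivations are derivations, so the commutation relations below need checking on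
    the variables only. *)
Lemma gen_ext (D D' : V -> V) : derivation D -> derivation D' ->
  (forall t k, D (var t k) = D' (var t k)) -> forall f, D f = D' f.
Proof.
move=> dD dD' DX; apply: derivation_ext => // l.
by have [[t k] ->] := gen_surj l; apply: DX.
Qed.

Lemma Fop_comm t u t' u' f : Fop t u (Fop t' u' f) - Fop t' u' (Fop t u f) =
  (u == t')%:R *: Fop t u' f - (u' == t)%:R *: Fop t' u f.
Proof.
have d1 := Fop_der t u; have d2 := Fop_der t' u'.
apply: (gen_ext (D := fun f => Fop t u (Fop t' u' f) - Fop t' u' (Fop t u f))
  (D' := fun f => (u == t')%:R *: Fop t u' f - (u' == t)%:R *: Fop t' u f)).
- exact: derivation_comm.
- by apply: derivation_lin; apply: Fop_der.
move=> v k; rewrite !FopX !(derivationZ d1) !(derivationZ d2) !FopX.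
by rewrite !scalerA; congr (_ *: _ - _ *: _); apply: mulrC.
Qed.

Lemma Gop_comm i j k l f : Gop i j (Gop k l f) - Gop k l (Gop i j f) =
  (j == k)%:R *: Gop i l f - (l == i)%:R *: Gop k j f.
Proof.
have d1 := Gop_der i j; have d2 := Gop_der k l.
apply: (gen_ext (D := fun f => Gop i j (Gop k l f) - Gop k l (Gop i j f))
  (D' := fun f => (j == k)%:R *: Gop i l f - (l == i)%:R *: Gop k j f)).
- exact: derivation_comm.
- by apply: derivation_lin; apply: Gop_der.
move=> v p; rewrite !GopX !(derivationZ d1) !(derivationZ d2) !GopX.
by rewrite !scalerA; congr (_ *: _ - _ *: _); apply: mulrC.
Qed.

Lemma FopG t u i j f : Fop t u (Gop i j f) = Gop i j (Fop t u f).
Proof.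
apply/eqP; rewrite -subr_eq0; apply/eqP.
have d1 := Fop_der t u; have d2 := Gop_der i j.
apply: (gen_ext (D := fun f => Fop t u (Gop i j f) - Gop i j (Fop t u f))
  (D' := fun=> 0)).
- exact: derivation_comm.
- exact: derivation_zero.
move=> v k; rewrite !FopX !GopX !(derivationZ d1) !(derivationZ d2) FopX GopX.
by rewrite !scalerA mulrC subrr.
Qed.

(** Normal ordering of either Casimir element leaves the same sum H of second-order terms. The
    remaining first-order terms are n times, respectively 2 times, the total degree operator. *)
Lemma Casimir f : \sum_i \sum_j Gop i j (Gop j i f) =
  \sum_t \sum_u Fop u t (Fop t u f) + (n%:R - 2%:R) *: \sum_t Fop t t f.
Proof.
pose H := \sum_i \sum_j \sum_t \sum_u
  var t i * (var u j * der t j (der u i f)).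
have GG : \sum_i \sum_j Gop i j (Gop j i f) = H + n%:R *: \sum_t Fop t t f.
  have -> : n%:R *: \sum_t Fop t t f = \sum_i \sum_(j < n) \sum_t var t i * der t i f.
    rewrite /Fop [X in _ *: X]exchange_big /= [RHS]exchange_big /=.
    by rewrite sumr_const card_ord scaler_nat.
  rewrite /H -big_split; apply: eq_bigr => i _ /=.
  rewrite -big_split; apply: eq_bigr => j _ /=.
  rewrite -big_split; apply: eq_bigr => t _ /=.
  rewrite {1}/der /Gop linear_sum /= mulr_sumr (bigD1 t) //=.
  rewrite [X in _ = X + _](bigD1 t) //= -/(der t j _) der_varM !eqxx scale1r.
  rewrite mulrDr [RHS]addrAC; congr (_ + _); apply: eq_bigr => u ut.
  by rewrite -/(der t j _) der_varM eq_sym (negPf ut) scale0r addr0.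
have FF : \sum_t \sum_u Fop u t (Fop t u f) = H + 2%:R *: \sum_t Fop t t f.
  rewrite /H.
  have -> : 2%:R *: \sum_t Fop t t f = \sum_(t : bool) \sum_u Fop u u f.
    by rewrite sumr_const card_bool scaler_nat.
  have -> : \sum_i \sum_j \sum_t \sum_u var t i * (var u j * der t j (der u i f))
    = \sum_t \sum_u \sum_j \sum_i var u j * (var t i * der t j (der u i f)).
    transitivity (\sum_i \sum_t \sum_u \sum_j
        var u j * (var t i * der t j (der u i f))).
      apply: eq_bigr => i _; rewrite exchange_big; apply: eq_bigr => t _ /=.
      rewrite exchange_big; apply: eq_bigr => u _; apply: eq_bigr => j _ /=.
      exact: mulrCA.
    rewrite exchange_big; apply: eq_bigr => t _ /=.
    rewrite exchange_big; apply: eq_bigr => u _ /=.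
    exact: exchange_big.
  rewrite -big_split; apply: eq_bigr => t _ /=.
  rewrite -big_split; apply: eq_bigr => u _ /=.
  rewrite {1}/Fop -big_split; apply: eq_bigr => j _ /=.
  rewrite {1}/der /Fop linear_sum /= mulr_sumr (bigD1 j) //=.
  rewrite [X in _ = X + _](bigD1 j) //= -/(der t j _) der_varM !eqxx scale1r.
  rewrite mulrDr [RHS]addrAC; congr (_ + _); apply: eq_bigr => i ij.
  by rewrite -/(der t j _) der_varM eq_sym (negPf ij) andbF scale0r addr0.
rewrite GG FF scalerBl -addrA; congr (_ + _).
by rewrite addrC subrK.
Qed.

Lemma mcoeff_var0 t i f m : m (gen (t, i)) = 0%N -> (var t i * f)@_m = 0.
Proof.
move=> m0; rewrite /var [f]mpolyE mulr_sumr raddf_sum big1 // => p _ /=.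
rewrite -scalerAr mcoeffZ -mpolyXD mcoeffX.
case: eqP => [pm|_]; last by rewrite mulr0.
by move: m0; rewrite -pm mnmDE mnm1E eqxx.
Qed.

Lemma mcoeff_var t i f m : (var t i * f)@_(m + U_(gen (t, i)))%MM = f@_m.
Proof. by rewrite /var mulrC addmC mcoeffMX. Qed.

Definition deg t m : nat := (\sum_i m (gen (t, i)))%N.
Definition wt m i : nat := (m (gen (true, i)) + m (gen (false, i)))%N.

Lemma mcoeff_Fdiag t f m : (Fop t t f)@_m = (deg t m)%:R * f@_m.
Proof.
rewrite /Fop raddf_sum natr_sum mulr_suml; apply: eq_bigr => i _ /=.
by rewrite mcoeff_numop.
Qed.

Lemma mcoeff_Gdiag i f m : (Gop i i f)@_m = (wt m i)%:R * f@_m.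
Proof. by rewrite /Gop big_bool mcoeffD !mcoeff_numop natrD mulrDl. Qed.

Lemma diag_eigen (D : V -> V) (phi : 'X_{1..n + n} -> nat) mu w :
  (forall f m, (D f)@_m = (phi m)%:R * f@_m) -> D w = mu *: w ->
  forall m, m \in msupp w -> mu = (phi m)%:R.
Proof.
move=> Dphi Dw m; rewrite mcoeff_msupp => wm.
by apply: (mulIf wm); rewrite -Dphi Dw mcoeffZ.
Qed.

Lemma natf_inj : injective (fun k : nat => k%:R : F).
Proof.
move=> x y xy; have := @intf_inj F charF x%:Z y%:Z.
by rewrite -!pmulrn => /(_ xy) [].
Qed.

(* At a monomial of w of least degree in the variable (~~ c, i), the coefficient
   of F_(c, ~~ c) w is that degree times the coefficient of w. *)
Lemma Fop0_msupp c i w : w != 0 -> Fop c (~~ c) w = 0 ->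
  exists2 m, m \in msupp w & m (gen (~~ c, i)) = 0%N.
Proof.
move=> w0 Fw; have [m0 m0w] := msupp_neq0 w0.
pose y := gen (~~ c, i); pose x := gen (c, i).
have exd : exists d, has (fun m => m y == d) (msupp w).
  by exists (m0 y); apply/hasP; exists m0.
have [d /hasP[m mw /eqP md] dmin] := ex_minnP exd.
exists m => //; rewrite -/y md; apply/eqP/negPn/negP => d0.
have yx : y != x by rewrite (inj_eq (@gen_inj n)) xpair_eqE; case: (c).
have my : (U_(y) <= m)%MM by rewrite lep1mP md.
have /eqP := congr1 (mcoeff (m - U_(y) + U_(x))%MM) Fw.
rewrite mcoeff0 /Fop raddf_sum (bigD1 i) //= big1 => [|j ji].
  rewrite mcoeff_var addr0 /der mcoeff_deriv submK // mnmBE mnm1E eqxx md.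
  rewrite -mulr_natr mulf_eq0 natf_eq0 // orbF.
  by rewrite mcoeff_eq0 mw.
(* For j different from i the contribution comes from a monomial whose exponent in y is d - 1, which
   is not in the support by minimality of d. *)
have [p0|p0] := eqVneq ((m - U_(y) + U_(x))%MM (gen (c, j))) 0%N.
  exact: mcoeff_var0.
have /submK <- : (U_(gen (c, j)) <= m - U_(y) + U_(x))%MM by rewrite lep1mP.
rewrite mcoeff_var /der mcoeff_deriv memN_msupp_eq0 ?mul0rn //.
set p := (_ + _)%MM; apply/negP => pw.
have := dmin (p y); rewrite (_ : has _ _); last by apply/hasP; exists p.
have y1 : gen (c, j) == y = false.
  by apply/negbTE; rewrite (inj_eq (@gen_inj n)) xpair_eqE; case: (c).
have y2 : gen (~~ c, j) == y = false.
  by apply/negbTE; rewrite (inj_eq (@gen_inj n)) xpair_eqE negb_and ji orbT.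
move=> /(_ isT); rewrite /p !(mnmDE, mnmBE, mnm1E) eqxx y1 y2.
by rewrite [x == y]eq_sym (negPf yx) md; lia.
Qed.

End HoweOperators.

(** * Extremal inequalities for weights *)

Section DominantWeights.
Context (n a b : nat) (mu : 'I_n -> nat).
Hypotheses (n_gt1 : (1 < n)%N) (ba : (b <= a)%N).
Hypotheses (sum_mu : (\sum_i mu i = a + b)%N) (mu_le : forall i, (mu i <= a)%N).

Definition top_weight : 'I_n -> nat :=
  fun i => (a * (i == 0 :> nat) + b * (i == 1 :> nat))%N.

(** If some part is at least b, it and the sum s of the others both lie between b and a and add up
    to a + b, and the squares of the others sum to at most s^2. If all parts are below b, the sum is
    at most b (a + b). *)
Lemma sum_sqr_le : (\sum_i mu i ^ 2 <= a ^ 2 + b ^ 2)%N.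
Proof.
have [/existsP[i bi]|] := boolP [exists i, (b <= mu i)%N].
  have ai := mu_le i; move: sum_mu; rewrite (bigD1 i) //=.
  rewrite [X in (X <= _)%N](bigD1 i) //=.
  set s := (\sum_(_ < _ | _) mu _)%N => sum_i.
  have : (\sum_(j < n | j != i) mu j ^ 2 <= s ^ 2)%N.
    rewrite -[X in (_ <= X)%N]mulnn {1}/s big_distrl /=; apply: leq_sum => j ji.
    by rewrite leq_mul2l /s (bigD1 j) //= leq_addr orbT.
  have [q muE] : exists q, mu i = (b + q)%N by exists (mu i - b)%N; lia.
  have [p aE] : exists p, a = (b + q + p)%N by exists (a - mu i)%N; lia.
  have -> : s = (b + p)%N by lia.
  rewrite muE aE; move: (\sum_(_ < _ | _) _)%N => r; rewrite -!mulnn; nia.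
rewrite negb_exists => /forallP mu_lt.
apply: (@leq_trans (\sum_i mu i * b)).
  apply: leq_sum => i _; rewrite leq_mul2l; have := mu_lt i; rewrite -ltnNge.
  by move/ltnW ->; rewrite orbT.
by rewrite -big_distrl /= sum_mu; nia.
Qed.

(** At most a sits at index 0, so at least b sits at positive indices, where it counts at least
    once, and at least twice from index 2 on. Equality therefore leaves nothing beyond index 1. *)
Lemma sum_index_ge : (b <= \sum_(i < n) i * mu i)%N /\
  ((\sum_(i < n) i * mu i)%N = b -> mu =1 top_weight).
Proof.
pose i0 : 'I_n := Ordinal (ltnW n_gt1); pose i1 : 'I_n := Ordinal n_gt1.
have split_sum (G : 'I_n -> nat) :
    (\sum_i G i = G i0 + (G i1 + \sum_(i < n | (i != i0) && (i != i1)) G i))%N.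
  by rewrite (bigD1 i0) //= (bigD1 i1).
move: sum_mu; rewrite !split_sum /=.
set r := (\sum_(_ < _ | _) mu _)%N; set t := (\sum_(_ < _ | _) _)%N => sum_i.
have rt : (2 * r <= t)%N.
  rewrite big_distrr; apply: leq_sum => i /andP[i_0 i_1].
  rewrite leq_mul2r; apply/orP; right.
  move: i_0 i_1; rewrite -!val_eqE /=; lia.
have a0 := mu_le i0; split=> [|sum_b]; first by lia.
have r0 : r = 0%N by lia.
move=> i; rewrite /top_weight.
have [->|i_0] := eqVneq i i0; first by rewrite /= muln1 muln0; lia.
have [->|i_1] := eqVneq i i1; first by rewrite /= muln1 muln0; lia.
have -> : (i == 0 :> nat) = false by apply: negPf i_0.
have -> : (i == 1 :> nat) = false by apply: negPf i_1.
rewrite !muln0; apply/eqP; rewrite -leqn0 -r0 /r (bigD1 i) ?leq_addr //=.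
by rewrite i_0.
Qed.

(* The difference of the eigenvalues of the Casimir element of gl_n at the
   highest weight (a, b, 0, ...) and at mu. *)
Definition Casimir_gap : int :=
  (a ^ 2 + b ^ 2)%N%:Z - (\sum_i mu i ^ 2)%N%:Z
  + 2 * ((\sum_(i < n) i * mu i)%N%:Z - b%:Z).

Lemma Casimir_gap_eq0 : Casimir_gap = 0 -> mu =1 top_weight.
Proof.
have := sum_sqr_le; have [] := sum_index_ge; rewrite /Casimir_gap.
move: (\sum_i mu i ^ 2)%N (\sum_(i < n) i * mu i)%N => x y.
move=> y_ge y_eq x_le gap0; apply: y_eq; lia.
Qed.

End DominantWeights.

(** * Irreducibility of the spaces of gl_2-highest weight vectors over gl_n *)

Section HighestWeight.
Context (F : fieldType) (charF : [pchar F] =i pred0) (n : nat).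
Hypothesis n_gt1 : (1 < n)%N.
Notation V := {mpoly F[n + n]}.
Notation Fop := (@Fop F n).
Notation Gop := (@Gop F n).
Implicit Types (c : bool) (f g w : V) (i j k l : 'I_n) (m : 'X_{1..n + n}).

(* The gl_2-highest weight vectors of weight (a, b). *)
Definition Khw c a b w : Prop :=
  [/\ Fop c c w = a%:R *: w, Fop (~~ c) (~~ c) w = b%:R *: w
    & Fop c (~~ c) w = 0].

Definition Gstable (W : V -> Prop) := forall i j f, W f -> W (Gop i j f).

Definition wvec g (mu : 'I_n -> nat) := forall k, Gop k k g = (mu k)%:R *: g.

Lemma Khw_subspace c a b : is_subspace (Khw c a b).
Proof.
have d t u := Fop_der F n t u.
split; first by split; rewrite ?(derivation0 (d _ _)) ?scaler0.
move=> k f g [f1 f2 f3] [g1 g2 g3]; split; rewrite (d _ _).1.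
- by rewrite f1 g1 scalerDr !scalerA mulrC.
- by rewrite f2 g2 scalerDr !scalerA mulrC.
- by rewrite f3 g3 scaler0 addr0.
Qed.

Lemma Khw_Gstable c a b : Gstable (Khw c a b).
Proof.
move=> i j f [f1 f2 f3]; have d := Gop_der F i j.
by split; rewrite FopG ?f1 ?f2 ?f3 ?(derivation0 d) // (derivationZ d).
Qed.

Section Weights.
Context (c : bool) (a b : nat) (ba : (b <= a)%N).

Lemma wvec_wt g mu m : wvec g mu -> m \in msupp g -> mu =1 wt m.
Proof.
move=> gmu mg k; apply: (natf_inj charF).
exact: (diag_eigen (mcoeff_Gdiag k) (gmu k) mg).
Qed.

Lemma Khw_deg g m : Khw c a b g -> m \in msupp g ->
  deg c m = a /\ deg (~~ c) m = b.
Proof.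
move=> [g1 g2 _] mg; split; apply: (natf_inj charF); symmetry.
  exact: (diag_eigen (mcoeff_Fdiag c) g1 mg).
exact: (diag_eigen (mcoeff_Fdiag (~~ c)) g2 mg).
Qed.

Lemma wtE m k : wt m k = (m (gen (c, k)) + m (gen (~~ c, k)))%N.
Proof. by rewrite /wt; case: (c) => //; rewrite addnC. Qed.

(** The bound uses a monomial of g free of the variable (~~ c, i), given by [Fop0_msupp]: there mu i
    is a single exponent of type c, and all these exponents sum to a. *)
Lemma Khw_weight g mu : Khw c a b g -> g != 0 -> wvec g mu ->
  (\sum_i mu i = a + b)%N /\ forall i, (mu i <= a)%N.
Proof.
move=> Kg g0 gmu; split.
  have [m mg] := msupp_neq0 g0; have [<- <-] := Khw_deg Kg mg.
  rewrite /deg -big_split; apply: eq_bigr => i _.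
  by rewrite (wvec_wt gmu mg) wtE.
move=> i; have [m mg mi] : exists2 m, m \in msupp g & m (gen (~~ c, i)) = 0%N.
  by case: Kg => _ _; apply: Fop0_msupp.
have [<- _] := Khw_deg Kg mg.
by rewrite (wvec_wt gmu mg) wtE mi addn0 /deg (bigD1 i) //= leq_addr.
Qed.

Lemma Khw_Casimir g : Khw c a b g -> \sum_i \sum_j Gop i j (Gop j i g) =
  ((a ^ 2 + b ^ 2)%:R + (a%:R - b%:R) + (n%:R - 2%:R) * (a + b)%:R) *: g.
Proof.
move=> [g1 g2 g3]; rewrite Casimir.
have d t u := Fop_der F n t u.
have sum_bool (G : bool -> V) : \sum_t G t = G c + G (~~ c).
  by rewrite big_bool; case: (c) => //; rewrite addrC.
have nc : (c == ~~ c) = false by case: (c).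
have FF : Fop c (~~ c) (Fop (~~ c) c g) = (a%:R - b%:R) *: g.
  have := Fop_comm c (~~ c) (~~ c) c g.
  rewrite g3 (derivation0 (d _ _)) subr0 !eqxx !scale1r => ->.
  by rewrite g1 g2 scalerBl.
rewrite !sum_bool g1 g2 g3 !(derivationZ (d _ _)) (derivation0 (d _ _)) g1 g2 FF.
rewrite !natrD !natrX addr0 -!mul_mpolyC !(rmorphD, rmorphB, rmorphM, rmorphXn) /=.
ring.
Qed.

Lemma count_above i : (\sum_(j < n | (i < j)%N) 1 = n - i.+1)%N.
Proof. by rewrite -(big_geq_mkord i.+1 n xpredT (fun=> 1%N)) sum_nat_const_nat muln1. Qed.

Lemma count_below j : (\sum_(i < n | (i < j)%N) 1 = j)%N.
Proof.
by rewrite -(big_ord_widen n (fun=> 1%N) (ltnW (ltn_ord j))) sum1_card card_ord.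
Qed.

(** The pairing of mu with the sum of the positive roots: mu k occurs n - 1 - k times with sign plus
    and k times with sign minus. *)
Lemma sum_weight_gap (mu : 'I_n -> nat) :
  \sum_(i < n) \sum_(j < n | (i < j)%N) ((mu i)%:Z - (mu j)%:Z) =
  (n%:Z - 1) * (\sum_i mu i)%N%:Z - 2 * (\sum_(i < n) i * mu i)%N%:Z.
Proof.
rewrite (eq_bigr (fun i : 'I_n => \sum_(j < n | (i < j)%N) (mu i)%:Z
    - \sum_(j < n | (i < j)%N) (mu j)%:Z)); last first.
  by move=> i _; rewrite -sumrN -big_split.
rewrite sumrB [X in _ - X](exchange_big_dep xpredT) //=.
rewrite !(big_morph Posz PoszD (erefl 0%:Z)) !mulr_sumr -!sumrB.
apply: eq_bigr => i _.
have const (Q : pred 'I_n) : \sum_(j < n | Q j) (mu i)%:Z = (mu i)%:Z * (\sum_(j < n | Q j) 1)%N%:Z.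
  by rewrite (big_morph Posz PoszD (erefl 0%:Z)) mulr_sumr; apply: eq_bigr => j _; rewrite mulr1.
rewrite !const count_above count_below.
have := ltn_ord i; rewrite PoszM; nia.
Qed.

(** The Casimir sum of gl_n is reordered so that the raising operators [Gop i j], i < j, act first;
    the commutators give the sum of weight differences. Comparison with the gl_2 eigenvalue in
    [Khw_Casimir] leaves the gap. *)
Lemma Casimir_gapE g mu : Khw c a b g -> g != 0 -> wvec g mu ->
  (Casimir_gap a b mu)%:~R *: g =
  2%:R *: \sum_(i < n) \sum_(j < n | (i < j)%N) Gop j i (Gop i j g).
Proof.
move=> Kg g0 gmu; have := Khw_Casimir Kg.
have [sum_mu _] := Khw_weight Kg g0 gmu.
pose X := \sum_(i < n) \sum_(j < n | (i < j)%N) Gop j i (Gop i j g).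
have -> : \sum_i \sum_j Gop i j (Gop j i g) =
   (\sum_i mu i ^ 2)%:R *: g + 2%:R *: X
   + (\sum_(i < n) \sum_(j < n | (i < j)%N) ((mu i)%:Z - (mu j)%:Z))%:~R *: g.
  have -> : (\sum_i mu i ^ 2)%:R *: g = \sum_i Gop i i (Gop i i g).
    rewrite natr_sum scaler_suml; apply: eq_bigr => i _.
    by rewrite gmu (derivationZ (Gop_der F i i)) gmu scalerA natrX.
  have -> : 2%:R *: X = X + \sum_(i < n) \sum_(j < n | (j < i)%N) Gop i j (Gop j i g).
    by rewrite scaler_nat mulr2n; congr (_ + _); rewrite /X (exchange_big_dep xpredT).
  rewrite rmorph_sum scaler_suml /X -!big_split; apply: eq_bigr => i _ /=.
  rewrite (bigID (fun j : 'I_n => (j < i)%N)) /= [X in _ + X](bigD1 i) ?ltnn //=.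
  rewrite (_ : \sum_(j < n | ~~ (j < i)%N && (j != i)) Gop i j (Gop j i g) =
    \sum_(j < n | (i < j)%N) Gop j i (Gop i j g)
    + (\sum_(j < n | (i < j)%N) ((mu i)%:Z - (mu j)%:Z))%:~R *: g).
    rewrite addrCA -[RHS]addrA; congr (_ + _).
    by rewrite addrA; congr (_ + _); rewrite addrC.
  rewrite rmorph_sum scaler_suml -big_split /=.
  apply: eq_big => [j|j ij]; first by rewrite -leqNgt -val_eqE /= ltn_neqAle andbC eq_sym.
  have := Gop_comm i j j i g; rewrite !eqxx !scale1r !gmu -scalerBl intrB => <-.
  by rewrite addrC subrK.
rewrite sum_weight_gap sum_mu => eqC.
suff : (Casimir_gap a b mu)%:~R *: g - 2%:R *: X = 0.
  by move/eqP; rewrite subr_eq0 => /eqP.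
move/eqP: eqC; rewrite eq_sym -subr_eq0 => /eqP <-.
rewrite /Casimir_gap -!mul_mpolyC.
rewrite !(intrD, intrB, intrN, intrM, rmorphD, rmorphB, rmorphN, rmorphM) -!pmulrn /=.
rewrite !mpolyC1; ring.
Qed.

Definition top_vec g := wvec g (top_weight a b).

(** Such a vector is determined by its coefficient at [m0]. If it is nonzero, it has a monomial free
    of (~~ c, 0); the weight puts exponent a on (c, 0), exhausting the degree in type c, so the
    other b units lie on (~~ c, 1). *)
Lemma top_vec_unique g h : Khw c a b g -> Khw c a b h -> g != 0 ->
  top_vec g -> top_vec h -> exists e, h = e *: g.
Proof.
pose i0 : 'I_n := Ordinal (ltnW n_gt1).
pose m0 := [multinom (if k == gen (c, i0) then a else
  if k == gen (~~ c, Ordinal n_gt1) then b else 0)%N | k < n + n].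
have vanish f : Khw c a b f -> top_vec f -> f@_m0 = 0 -> f = 0.
  move=> Kf tf fm0; apply/eqP/negPn/negP => f0.
  have [m mf mi] : exists2 m, m \in msupp f & m (gen (~~ c, i0)) = 0%N.
    by case: Kf => _ _; apply: Fop0_msupp.
  have wtm k : wt m k = top_weight a b k by rewrite (wvec_wt tf mf).
  have m_i0 : m (gen (c, i0)) = a.
    by have := wtm i0; rewrite wtE mi /top_weight /= muln1 muln0 !addn0.
  have mc k : k != i0 -> m (gen (c, k)) = 0%N.
    have [] := Khw_deg Kf mf; rewrite /deg (bigD1 i0) //= m_i0 => /eqP.
    rewrite -[X in _ == X]addn0 eqn_add2l sum_nat_eq0 => /forallP H _ ki.
    by apply/eqP; have := H k; rewrite ki.
  suff mm0 : m = m0 by move: mf; rewrite mm0 mcoeff_msupp fm0 eqxx.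
  apply/mnmP => l; rewrite mnmE; have [[t k] ->] := gen_surj l.
  rewrite !(inj_eq (@gen_inj n)) !xpair_eqE.
  have [->|tc] := eqVneq t c.
    rewrite /= (_ : (c == ~~ c) = false) /=; last by case: (c).
    by case: eqVneq => [->|/mc].
  have {t tc}-> : t = ~~ c by move: tc; case: (t) (c) => [] [].
  rewrite eqxx /=; have := wtm k; rewrite wtE /top_weight.
  have [->|ki] := eqVneq k i0; first by rewrite mi.
  rewrite mc // (_ : (k == 0 :> nat) = false) ?muln0; last exact: negPf ki.
  by rewrite !add0n -[k == Ordinal _]val_eqE /=; case: eqP => _; rewrite ?muln1 ?muln0.
move=> Kg Kh g0 tg th; have sK := Khw_subspace c a b.
have gm0 : g@_m0 != 0 by apply: contraNneq g0 => gm; rewrite (vanish g).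
exists (h@_m0 / g@_m0); apply/eqP; rewrite -subr_eq0; apply/eqP; apply: vanish.
- by apply: subspaceB => //; apply: subspaceZ.
- move=> k; have d := Gop_der F k k.
  by rewrite (derivationB d) (derivationZ d) tg th scalerBr !scalerA mulrC.
- by rewrite mcoeffB mcoeffZ mulfVK // subrr.
Qed.

Definition height (mu : 'I_n -> nat) := (\sum_(k < n) k * mu k)%N.

(** The weight changes by +1 at i and -1 at j, so the height changes by i - j. The new weight is
    read off a monomial of the support, which makes it a tuple of natural numbers. *)
Lemma wvec_raise g mu i j : wvec g mu -> (i < j)%N -> Gop i j g != 0 ->
  exists2 nu, wvec (Gop i j g) nu & (height nu < height mu)%N.
Proof.
move=> gmu ij Gg0; have [m mG] := msupp_neq0 Gg0.
have scal k : Gop k k (Gop i j g) =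
    ((mu k)%:Z + (k == i)%:Z - (k == j)%:Z)%:~R *: Gop i j g.
  have := Gop_comm k k i j g; rewrite gmu (derivationZ (Gop_der F i j)).
  rewrite !intrD intrN -!pmulrn => /eqP; rewrite subr_eq => /eqP ->.
  have -> : (k == i)%:R *: Gop k j g = (k == i)%:R *: Gop i j g.
    by case: eqVneq => [->|_] //; rewrite !scale0r.
  have -> : (j == k)%:R *: Gop i k g = (k == j)%:R *: Gop i j g.
    by rewrite eq_sym; case: eqVneq => [->|_] //; rewrite !scale0r.
  by rewrite scalerBl scalerDl addrC addrA.
have nuE k : (wt m k)%:Z = (mu k)%:Z + (k == i)%:Z - (k == j)%:Z.
  apply: (intf_inj charF); rewrite -pmulrn; symmetry.
  exact: (diag_eigen (mcoeff_Gdiag k) (scal k) mG).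
exists (wt m) => [k|]; first by rewrite scal -nuE -pmulrn.
suff : (height (wt m))%:Z = (height mu)%:Z + i%:Z - j%:Z by lia.
rewrite /height !(big_morph Posz PoszD (erefl 0%:Z)).
rewrite (eq_bigr (fun k : 'I_n => (k * mu k)%N%:Z + k%:Z * (k == i)%:Z - k%:Z * (k == j)%:Z)).
  rewrite sumrB big_split /=; congr (_ + _ - _).
    rewrite (bigD1 i) //= eqxx mulr1 big1 ?addr0 // => k /negPf ->.
    by rewrite mulr0.
  rewrite (bigD1 j) //= eqxx mulr1 big1 ?addr0 // => k /negPf ->.
  by rewrite mulr0.
by move=> k _; rewrite PoszM nuE mulrBr mulrDr PoszM.
Qed.

(* The Casimir identity writes a weight vector that is not of weight (a, b, 0, ...)
   through vectors G_ij g, i < j, of smaller height. *)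
Lemma Khw_irr (U : V -> Prop) : is_subspace U -> Gstable U ->
  (forall g, U g -> Khw c a b g) -> (exists2 g, U g & g != 0) ->
  forall g, Khw c a b g -> U g.
Proof.
move=> sU UG UK [g0 Ug0 g00].
have sK := Khw_subspace c a b.
have step g mu : Khw c a b g -> g != 0 -> wvec g mu ->
    top_vec g \/ ((Casimir_gap a b mu)%:~R : F) != 0.
  move=> Kg gn0 gmu; have [sum_mu mu_le] := Khw_weight Kg gn0 gmu.
  have [gap0|gap] := eqVneq (Casimir_gap a b mu) 0.
    left=> k; rewrite gmu; congr (_%:R *: _).
    exact: (Casimir_gap_eq0 n_gt1 ba sum_mu mu_le gap0).
  by right; rewrite intf_eq0.
(* Raising inside U lowers the height and must stop; where every raising operator vanishes, the
   Casimir identity forces the gap to be 0, hence the top weight. *)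
have [v [Uv v0 topv]] : exists v, [/\ U v, v != 0 & top_vec v].
  have [g [Ug gn0 gwt]] := diag_exists (@mcoeff_Gdiag F n) sU (fun i f => UG i i f) Ug0 g00.
  have [m mg] := msupp_neq0 gn0.
  have gmu : wvec g (wt m) by move=> k; apply: gwt.
  move: (wt m) gmu => mu; move: {2}_.+1 (ltnSn (height mu)) => k.
  elim: k g mu Ug gn0 {gwt mg} => // k IHk g mu Ug gn0 ltk gmu.
  have [top|gap] := step g mu (UK g Ug) gn0 gmu; first by exists g.
  have [[i [j [ij Gij]]]|none] :=
      classic (exists i j, (i < j)%N /\ Gop i j g != 0); last first.
    case/eqP: (gn0); apply: (scalerI gap).
    rewrite (Casimir_gapE (UK g Ug) gn0 gmu) scaler0 big1 ?scaler0 // => i _.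
    rewrite big1 // => j ij; have [->|Gij] := eqVneq (Gop i j g) 0.
      exact: derivation0 (Gop_der F j i).
    by case: none; exists i, j.
  have [nu Gnu lt_nu] := wvec_raise gmu ij Gij.
  by apply: (IHk (Gop i j g) nu) => //; [apply: UG | apply: leq_trans lt_nu ltk].
(* Conversely every weight vector is reached from v: at the top weight by uniqueness, elsewhere by
   induction on the height through the Casimir identity. *)
apply: (diag_ind (@mcoeff_Gdiag F n) sK sU) => [i f|g Kg gn0 gwt].
  exact: Khw_Gstable.
have [m mg] := msupp_neq0 gn0.
have gmu : wvec g (wt m) by move=> k; apply: gwt.
move: (wt m) gmu => mu; move: {2}_.+1 (ltnSn (height mu)) => k.
elim: k g mu Kg gn0 {gwt mg} => // k IHk g mu Kg gn0 ltk gmu.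
have [top|gap] := step g mu Kg gn0 gmu.
  have [k' ->] := top_vec_unique (UK v Uv) Kg v0 topv top.
  exact: subspaceZ.
apply: (subspaceZK sU gap); rewrite (Casimir_gapE Kg gn0 gmu).
apply: subspaceZ => //; apply: subspace_sum => // i _; apply: subspace_sum => // j ij.
apply: UG; have [->|Gij] := eqVneq (Gop i j g) 0; first by case: sU.
have [nu Gnu lt_nu] := wvec_raise gmu ij Gij.
apply: (IHk _ nu) => //; first exact: Khw_Gstable.
exact: leq_trans lt_nu ltk.
Qed.

End Weights.
End HighestWeight.

(** * Lowering operators of gl_2 and the components F^s K *)

Section Decomposition.
Context (F : fieldType) (charF : [pchar F] =i pred0) (n : nat).
Context (c : bool).
Notation V := {mpoly F[n + n]}.
Notation Fop := (@Fop F n).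
Notation Gop := (@Gop F n).
Notation up := (Fop c (~~ c)).
Notation lo := (Fop (~~ c) c).
Notation Khw := (@Khw F n c).
Implicit Types (f g w : V) (i j k l : 'I_n) (m : 'X_{1..n + n}).

Let d t u : derivation (Fop t u) := Fop_der F n t u.

Let neq_c : (c == ~~ c) = false. Proof. by case: (c). Qed.
Let neq_c' : (~~ c == c) = false. Proof. by case: (c). Qed.

Lemma lo_degc f : Fop c c (lo f) = lo (Fop c c f) - lo f.
Proof.
have := Fop_comm c c (~~ c) c f; rewrite neq_c eqxx scale0r scale1r sub0r.
by move/eqP; rewrite subr_eq => /eqP ->; rewrite addrC.
Qed.

Lemma lo_degcc f : Fop (~~ c) (~~ c) (lo f) = lo (Fop (~~ c) (~~ c) f) + lo f.
Proof.
have := Fop_comm (~~ c) (~~ c) (~~ c) c f; rewrite neq_c eqxx scale0r scale1r subr0.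
by move/eqP; rewrite subr_eq => /eqP ->; rewrite addrC.
Qed.

Lemma up_degc f : Fop c c (up f) = up (Fop c c f) + up f.
Proof.
have := Fop_comm c c c (~~ c) f; rewrite neq_c' eqxx scale0r scale1r subr0.
by move/eqP; rewrite subr_eq => /eqP ->; rewrite addrC.
Qed.

Lemma up_degcc f : Fop (~~ c) (~~ c) (up f) = up (Fop (~~ c) (~~ c) f) - up f.
Proof.
have := Fop_comm (~~ c) (~~ c) c (~~ c) f; rewrite neq_c' eqxx scale0r scale1r sub0r.
by move/eqP; rewrite subr_eq => /eqP ->; rewrite addrC.
Qed.

Lemma up_lo f : up (lo f) = lo (up f) + (Fop c c f - Fop (~~ c) (~~ c) f).
Proof.
have := Fop_comm c (~~ c) (~~ c) c f; rewrite !eqxx !scale1r => <-.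
by rewrite addrC subrK.
Qed.

Definition bideg (p q : F) w : Prop :=
  Fop c c w = p *: w /\ Fop (~~ c) (~~ c) w = q *: w.

Lemma bideg_subspace p q : is_subspace (bideg p q).
Proof.
split; first by split; rewrite (derivation0 (d _ _)) scaler0.
move=> k f g [f1 f2] [g1 g2]; split; rewrite (d _ _).1.
- by rewrite f1 g1 scalerDr !scalerA mulrC.
- by rewrite f2 g2 scalerDr !scalerA mulrC.
Qed.

Lemma bideg_lo p q w : bideg p q w -> bideg (p - 1) (q + 1) (lo w).
Proof.
move=> [w1 w2]; split; rewrite ?lo_degc ?lo_degcc ?w1 ?w2 (derivationZ (d _ _)).
  by rewrite scalerBl scale1r.
by rewrite scalerDl scale1r.
Qed.

Lemma bideg_up p q w : bideg p q w -> bideg (p + 1) (q - 1) (up w).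
Proof.
move=> [w1 w2]; split; rewrite ?up_degc ?up_degcc ?w1 ?w2 (derivationZ (d _ _)).
  by rewrite scalerDl scale1r.
by rewrite scalerBl scale1r.
Qed.

Lemma bideg_iter_lo p q s w : bideg p q w ->
  bideg (p - s%:R) (q + s%:R) (iter s lo w).
Proof.
elim: s => [|s IHs] bw; first by rewrite subr0 addr0.
rewrite iterS -[s.+1]addn1 natrD opprD !addrA.
exact: bideg_lo (IHs bw).
Qed.

Lemma up_iter_lo a b s w : Khw a b w ->
  up (iter s.+1 lo w) = (s.+1%:R * (a%:R - b%:R - s%:R)) *: iter s lo w.
Proof.
move=> [w1 w2 w3]; elim: s => [|s IHs].
  rewrite /= up_lo w3 (derivation0 (d _ _)) add0r w1 w2 -scalerBl.
  by rewrite mul1r subr0.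
have [deg1 deg2] := bideg_iter_lo s.+1 (conj w1 w2).
rewrite iterS up_lo IHs deg1 deg2 (derivationZ (d _ _)) -iterS -scalerBl -scalerDl.
by congr (_ *: _); rewrite -!natr1; ring.
Qed.

Lemma iter_lo_linear s e f g :
  iter s lo (e *: f + g) = e *: iter s lo f + iter s lo g.
Proof. by elim: s => //= s ->; rewrite (d _ _).1. Qed.

Lemma iter_lo0 s : iter s lo 0 = 0.
Proof. by elim: s => //= s ->; rewrite (derivation0 (d _ _)). Qed.

Lemma iter_lo_Gop s i j f : Gop i j (iter s lo f) = iter s lo (Gop i j f).
Proof. by elim: s => //= s <-; rewrite FopG. Qed.

Lemma iter_lo_inj a b s w : (b + s <= a)%N -> Khw a b w ->
  iter s lo w = 0 -> w = 0.
Proof.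
move=> bsa Kw; elim: s bsa => [//|s IHs] bsa lo0; apply: IHs; first by lia.
have := up_iter_lo s Kw; rewrite lo0 (derivation0 (d _ _)) => /esym/eqP.
rewrite scaler_eq0 mulf_eq0 natf_eq0 //= => /orP[|/eqP //].
by rewrite -natrB ?(leq_trans _ bsa) ?leq_addr // -natrB ?natf_eq0 //; lia.
Qed.

(** The highest weight is chosen so that s lowerings end at the degrees b + s + kap and b + s, whose
    difference kap is the same for all components. *)
Definition Kcomp (kap s b : nat) w : Prop :=
  exists2 u, Khw (b + 2 * s + kap) b u & w = iter s lo u.

Lemma Kcomp_subspace kap s b : is_subspace (Kcomp kap s b).
Proof.
have [K0 KL] := Khw_subspace F n c (b + 2 * s + kap) b.
split; first by exists 0; rewrite ?iter_lo0.
move=> k _ _ [u Ku ->] [v Kv ->]; exists (k *: u + v); first exact: KL.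
by rewrite iter_lo_linear.
Qed.

Lemma Kcomp_Gstable kap s b : Gstable (Kcomp kap s b).
Proof.
move=> i j _ [u Ku ->]; exists (Gop i j u); last exact: iter_lo_Gop.
exact: Khw_Gstable.
Qed.

Lemma Kcomp_bideg kap s b w : Kcomp kap s b w ->
  bideg (b + s + kap)%:R (b + s)%:R w.
Proof.
move=> [u [u1 u2 _] ->]; have := bideg_iter_lo s (conj u1 u2).
rewrite -natrB -?natrD; last by lia.
by congr (bideg _%:R _ _); lia.
Qed.

(** This eigenvalue takes the place of the gl_2 Casimir element; for fixed kap it is strictly
    increasing in s. *)
Lemma Kcomp_lo_up kap s b w : Kcomp kap s b w ->
  lo (up w) = (s * (s + kap + 1))%:R *: w.
Proof.
move=> [u Ku ->]; case: s Ku => [|s] Ku.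
  by case: Ku => _ _ /= ->; rewrite (derivation0 (d _ _)) scale0r.
rewrite (up_iter_lo _ Ku) (derivationZ (d _ _)) -iterS; congr (_ *: _).
rewrite -natrB; last by lia.
by rewrite -natrB -?natrM; [congr _%:R|]; lia.
Qed.

(** The lowering operator commutes with gl_n, so a submodule pulls back to the space of highest
    weight vectors, where [Khw_irr] applies. *)
Lemma Kcomp_irr kap s b (U : V -> Prop) : (1 < n)%N -> is_subspace U -> Gstable U ->
  (forall g, U g -> Kcomp kap s b g) -> (exists2 g, U g & g != 0) ->
  forall g, Kcomp kap s b g -> U g.
Proof.
move=> n_gt1 sU UG UK [g Ug g0] _ [u Ku ->].
pose U' w := Khw (b + 2 * s + kap) b w /\ U (iter s lo w).
suff : U' u by case.
have sK := Khw_subspace F n c (b + 2 * s + kap) b.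
apply: (@Khw_irr F charF n n_gt1 c (b + 2 * s + kap) b) (Ku).
- by lia.
- split; first by split; [case: sK | rewrite iter_lo0; case: sU].
  move=> k f h [Kf Uf] [Kh Uh]; split; first exact: (proj2 sK).
  by rewrite iter_lo_linear; apply: (proj2 sU).
- move=> i j f [Kf Uf]; split; first exact: Khw_Gstable.
  by rewrite -iter_lo_Gop; apply: UG.
- by move=> f [].
- have [v Kv gv] := UK g Ug; exists v; first by split=> //; rewrite -gv.
  by apply: contraNneq g0 => v0; rewrite gv v0 iter_lo0.
Qed.

Lemma bideg_neg p w : bideg p (-1) w -> w = 0.
Proof.
move=> [_ w2]; apply/eqP/negPn/negP => w0; have [m mw] := msupp_neq0 w0.
have := diag_eigen (mcoeff_Fdiag (~~ c)) w2 mw.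
move/eqP; rewrite eq_sym -subr_eq0 opprK natr1 natf_eq0 //.
Qed.

(* By induction F_(c, ~~ c) w lies in the span of the components, each of which
   is F_(c, ~~ c) of a component one step lower since the factor in
   [up_iter_lo] does not vanish. *)
Lemma bideg_Kcomp q kap w : bideg (q + kap)%:R q%:R w ->
  lin_span (fun g => exists s b, (s + b = q)%N /\ Kcomp kap s b g) w.
Proof.
elim: q kap w => [|q IHq] kap w bw.
  have up0 : up w = 0.
    by have := bideg_up bw; rewrite sub0r => /bideg_neg.
  apply: lin_span_mem; exists 0%N, 0%N; split=> //; exists w => //.
  by case: bw => w1 w2; split.
pose S kap q g := exists s b, (s + b = q)%N /\ Kcomp kap s b g.
have sS := lin_span_subspace (S kap q.+1).
pose Y y := exists w', [/\ lin_span (S kap q.+1) w',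
  bideg (q.+1 + kap)%:R q.+1%:R w' & up w' = y].
have [w' [Sw' bw' upw']] : Y (up w).
  (* Raising moves one unit of degree between the two types, so [up w] has degrees q + kap + 2 and
     q, and the difference grows to kap + 2. *)
  apply: (@lin_span_min _ _ (S (kap + 2)%N q)).
  - have [b0 bL] := bideg_subspace (q.+1 + kap)%:R q.+1%:R.
    split; first by exists 0; split; [case: sS | | rewrite (derivation0 (d _ _))].
    move=> k _ _ [f [Sf bf <-]] [g [Sg bg <-]]; exists (k *: f + g); split.
    + exact: (proj2 sS).
    + exact: bL.
    + by rewrite (d _ _).1.
  - move=> _ [s [b [sb [u Ku ->]]]].
    have Ku' : Khw (b + 2 * s.+1 + kap) b u.
      by move: Ku; congr (Khw _ _ _); lia.
    have Kw : Kcomp kap s.+1 b (iter s.+1 lo u) by exists u.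
    pose k : F := s.+1%:R * ((b + 2 * s.+1 + kap)%:R - b%:R - s%:R).
    have k0 : k != 0.
      apply: mulf_neq0; first by rewrite natf_eq0.
      rewrite -natrB; last by lia.
      rewrite -natrB; last by lia.
      by rewrite natf_eq0 //; lia.
    exists (k^-1 *: iter s.+1 lo u); split.
    + apply: subspaceZ => //; apply: lin_span_mem; exists s.+1, b; split=> //.
      by rewrite addSn sb.
    + apply: subspaceZ; first exact: bideg_subspace.
      by have := Kcomp_bideg Kw; congr (bideg _%:R _%:R _); lia.
    + by rewrite (derivationZ (d _ _)) (up_iter_lo s Ku') scalerA mulVf // scale1r.
  - apply: IHq; have := bideg_up bw.
    have -> : q.+1%:R - 1 = q%:R :> F by rewrite -natr1 addrK.
    rewrite natr1.
    by congr (bideg _%:R _ _); lia.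
rewrite -[w](subrK w'); apply: subspaceD => //.
(* The difference w - w' is killed by [up], so it is a highest weight vector itself. *)
apply: lin_span_mem; exists 0%N, q.+1; split=> //.
exists (w - w') => //; split.
- case: bw bw' => [w1 _] [w1' _].
  by rewrite (derivationB (d _ _)) w1 w1' -scalerBr muln0 addn0.
- case: bw bw' => [_ w2] [_ w2'].
  by rewrite (derivationB (d _ _)) w2 w2' -scalerBr.
- by rewrite (derivationB (d _ _)) upw' subrr.
Qed.

(** Components with different s are separated by lo after up, those with equal s by the degree. The
    injection [phi] selects a subfamily of the b, such as those of one parity. *)
Lemma Kcomp_free kap (phi : nat -> nat) (s : seq (nat * nat)) (u : nat * nat -> V) :
  injective phi -> uniq s -> (forall x, Kcomp kap x.1 (phi x.2) (u x)) ->
  \sum_(x <- s) u x = 0 -> forall x, x \in s -> u x = 0.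
Proof.
move=> phi_inj us Ku.
pose L (t : bool) f := if t then Fop (~~ c) (~~ c) f else lo (up f).
pose lam (t : bool) (x : nat * nat) : F :=
  if t then (phi x.2 + x.1)%:R else (x.1 * (x.1 + kap + 1))%:R.
apply: (eigenvectors_free (L := L) (lam := lam)) => //.
- by case=> k f g; rewrite /L (d _ _).1 // (d _ _).1.
- move=> [s1 b1] [s2 b2] _ _ neq.
  have [s12|s12] := eqVneq s1 s2; [exists true | exists false];
    apply: contra neq => /eqP/(natf_inj charF); rewrite /= xpair_eqE.
    by rewrite s12 eqxx /= => /addIn/phi_inj ->.
  move=> eq12; case/negP: s12; apply/eqP; nia.
- move=> x [] /=; first by case: (Kcomp_bideg (Ku x)).
  exact: Kcomp_lo_up (Ku x).
Qed.

End Decomposition.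

(** * Decomposition into K-modules when n1 = n2 = n *)

Section KTypes.
Context (F : fieldType) (charF : [pchar F] =i pred0) (n : nat).
Hypothesis n_gt1 : (1 < n)%N.
Notation V := {mpoly F[n + n]}.
Notation Fop := (@Fop F n).
Notation Gop := (@Gop F n).
Notation var := (@var F n).
Notation Khw := (@Khw F n).
Notation Kcomp := (@Kcomp F n).
Notation bideg := (@bideg F n).
Notation sig := (@reflection F n n).
Implicit Types (c t : bool) (f g w : V) (i j k l : 'I_n) (m : 'X_{1..n + n}).

Lemma sp_act_gl_Gop i j f :
  sp_act n n (gl_root F i j) f = - Gop j i f - f *+ (i == j).
Proof.
rewrite sp_act_gl_root /Ex /Ey !ltn_ord /Gop big_bool /= /var /der /gen /=.
by rewrite opprD addrAC.
Qed.

(** The basis elements of K act by - G_ji up to a scalar, and scalars preserve every subspace. *)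
Lemma K_submoduleP (W : V -> Prop) :
  is_submodule (@sp_act F n n n) (K_alg F n) W <-> is_subspace W /\ Gstable W.
Proof.
split=> -[sW Wact]; split=> //.
  move=> i j f Wf.
  have -> : Gop i j f = - (sp_act n n (gl_root F j i) f + f *+ (j == i)).
    by rewrite sp_act_gl_Gop subrK opprK.
  apply: subspaceN => //; apply: subspaceD => //.
    apply: Wact => //; rewrite /K_alg memvE.
    by apply: (sumv_sup j) => //; apply: (sumv_sup i).
  by rewrite -scaler_nat; apply: subspaceZ.
move=> M f KM Wf.
pose ok (M : 'M[F]_(n + n)) := W (sp_act n n M f).
have act0 : sp_act n n 0 f = 0.
  by have := sp_act_linear n n f (-1) 0 0; rewrite scaler0 addr0 scaleN1r addNr.
have ok0 : ok 0 by rewrite /ok act0; case: sW.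
have okD M1 M2 : ok M1 -> ok M2 -> ok (M1 + M2).
  by rewrite /ok sp_actD; apply: subspaceD.
have [M1 HM1 ->] := memv_sumP KM; apply: (big_ind ok) => // i _.
have [M2 HM2 ->] := memv_sumP (HM1 i isT); apply: (big_ind ok) => // j _.
have /vlineP[e ->] := HM2 j isT.
have := sp_act_linear n n f e (gl_root F i j) 0; rewrite act0 !addr0 /ok => ->.
apply: subspaceZ => //; rewrite sp_act_gl_Gop; apply: subspaceB => //.
  by apply: subspaceN => //; apply: Wact.
by rewrite -scaler_nat; apply: subspaceZ.
Qed.

Let i0 : 'I_n := Ordinal (ltnW n_gt1).
Let i1 : 'I_n := Ordinal n_gt1.

(** A 2 x 2 minor of the matrix of variables with two rows and n columns. Its powers times powers of
    one variable are the classical highest weight vectors for gl_2 and gl_n. *)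
Definition Delta c : V := var c i0 * var (~~ c) i1 - var c i1 * var (~~ c) i0.

Definition top_poly c b e : V := Delta c ^+ b * var c i0 ^+ e.

Let d t u : derivation (Fop t u) := Fop_der F n t u.

Lemma Delta_neq0 c : Delta c != 0.
Proof.
have /eqP : (Delta c)@_(U_(gen (c, i0)) + U_(gen (~~ c, i1))) = 1.
  rewrite /Delta /var -!mpolyXD mcoeffB !mcoeffX eqxx.
  rewrite (negPf (_ : _ != (_ + _)%MM)) ?subr0 //.
  apply/eqP => /mnmP eqm; have := eqm (gen (c, i0)).
  rewrite !mnmDE !mnm1E !(inj_eq (@gen_inj n)) !xpair_eqE eqxx /=.
  by rewrite andbF; case: (c).
by apply: contraTneq => ->; rewrite mcoeff0 eq_sym oner_eq0.
Qed.

Lemma top_poly_neq0 c b e : top_poly c b e != 0.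
Proof.
by rewrite mulf_neq0 // expf_neq0 ?Delta_neq0 // /var mpolyX_neq0.
Qed.

Lemma Khw_top_poly c b e : Khw c (b + e) b (top_poly c b e).
Proof.
have nc : (c == ~~ c) = false by case: (c).
have nc' : (~~ c == c) = false by case: (c).
have DD t u mu : Fop t u (Delta c) = mu *: Delta c ->
    forall nu, Fop t u (var c i0) = nu *: var c i0 ->
    Fop t u (top_poly c b e) = (b%:R * mu + e%:R * nu) *: top_poly c b e.
  move=> Dmu nu Xnu; rewrite /top_poly (d _ _).2.
  rewrite (derivationX_eigen (d _ _) _ Dmu) (derivationX_eigen (d _ _) _ Xnu).
  by rewrite -scalerAl -scalerAr -scalerDl.
have FD t u : Fop t u (Delta c) =
    Fop t u (var c i0) * var (~~ c) i1 + var c i0 * Fop t u (var (~~ c) i1)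
    - (Fop t u (var c i1) * var (~~ c) i0 + var c i1 * Fop t u (var (~~ c) i0)).
  by rewrite /Delta (derivationB (d _ _)) !(d _ _).2.
split.
- rewrite (DD _ _ 1 _ 1); first by rewrite !mulr1 natrD.
    by rewrite FD !FopX eqxx nc !scale1r !scale0r !mulr0 !addr0.
  by rewrite FopX eqxx.
- rewrite (DD _ _ 1 _ 0); first by rewrite mulr1 mulr0 addr0.
    by rewrite FD !FopX eqxx nc' !scale1r !scale0r !mul0r !add0r.
  by rewrite FopX nc' !scale0r.
- rewrite (DD _ _ 0 _ 0); first by rewrite !mulr0 addr0 scale0r.
    rewrite FD !FopX eqxx nc' !scale1r !scale0r !mul0r !add0r.
    by rewrite mulrC subrr.
  by rewrite FopX nc' !scale0r.
Qed.

Lemma Kcomp_neq0 c kap s b : exists2 f, Kcomp c kap s b f & f != 0.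
Proof.
have Kt : Khw c (b + 2 * s + kap) b (top_poly c b (2 * s + kap)).
  by rewrite -addnA; apply: Khw_top_poly.
exists (iter s (Fop (~~ c) c) (top_poly c b (2 * s + kap))).
  by exists (top_poly c b (2 * s + kap)).
apply: contraNneq (top_poly_neq0 c b (2 * s + kap)) => lo0.
by apply/eqP; have := iter_lo_inj charF _ Kt lo0; apply; lia.
Qed.

Lemma Kcomp_irreducible c kap s b :
  irreducible_submodule (@sp_act F n n n) (K_alg F n) (Kcomp c kap s b).
Proof.
split.
- by apply/K_submoduleP; split; [apply: Kcomp_subspace | apply: Kcomp_Gstable].
- by have [f Kf f0] := Kcomp_neq0 c kap s b; exists f => //; apply/eqP.
- move=> U /K_submoduleP[sU UG] UK.
  have [[f Uf f0]|none] := classic (exists2 f, U f & f != 0).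
    by right; apply: (Kcomp_irr charF n_gt1 sU UG UK); exists f.
  left=> f Uf; apply/eqP/negPn/negP => f0; apply: none.
  by exists f.
Qed.

Lemma bideg_deg c p q w m : bideg c p%:R q%:R w -> m \in msupp w ->
  deg c m = p /\ deg (~~ c) m = q.
Proof.
move=> [w1 w2] mw; split; apply: (natf_inj charF); symmetry.
  exact: (diag_eigen (mcoeff_Fdiag c) w1 mw).
exact: (diag_eigen (mcoeff_Fdiag (~~ c)) w2 mw).
Qed.

Lemma mdeg_deg c m : mdeg m = (deg c m + deg (~~ c) m)%N.
Proof.
rewrite mdegE big_split_ord /=.
by case: c => //=; rewrite [RHS]addnC.
Qed.

Lemma bideg_fin_dim c p q (W : V -> Prop) : is_subspace W ->
  (forall w, W w -> bideg c p%:R q%:R w) -> fin_dim W.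
Proof.
move=> sW Wb.
pose monomials := codom (fun x : bmultinom (n + n) (p + q).+1 => 'X_[val x] : V).
apply: (@fin_dim_sub _ _ monomials) => // w Ww.
rewrite [w]mpolyE; apply: subspace_sum_seq; first exact: lin_span_subspace.
move=> m mw; apply: subspaceZ; first exact: lin_span_subspace.
apply: lin_span_mem; have [degp degq] := bideg_deg (Wb w Ww) mw.
have mlt : (mdeg m < (p + q).+1)%N by rewrite (mdeg_deg c) degp degq.
by apply/codomP; exists (BMultinom mlt).
Qed.

Lemma GK_of_Kcomp c kap (phi : nat -> nat) (W : V -> Prop) : injective phi ->
  sp_irreducible n n W ->
  (forall s b g, Kcomp c kap s (phi b) g -> W g) ->
  (forall f, W f ->
     lin_span (fun g => exists x : nat * nat, Kcomp c kap x.1 (phi x.2) g) f) ->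
  GK_type n n W.
Proof.
move=> phi_inj irrW KW WK; have n_gt0 := ltnW n_gt1; split=> //.
  exact: not_fin_dim irrW.
exists (nat * nat)%type, (fun x => Kcomp c kap x.1 (phi x.2)); split.
  split.
  - by move=> x f; apply: KW.
  - by move=> f /WK; apply: lin_span_family => x; apply: Kcomp_subspace.
  - by move=> s u us Ku; apply: (Kcomp_free charF phi_inj us Ku).
move=> x; split; last exact: Kcomp_irreducible.
apply: bideg_fin_dim (Kcomp_bideg (kap := kap) (s := x.1) (b := phi x.2) (c := c)).
exact: Kcomp_subspace.
Qed.

Lemma grade_deg m : grade n n m = (deg false m)%:Z - (deg true m)%:Z.
Proof.
rewrite gradeE -(pair_bigA _ (fun t i => eps n n (t, i) * (m (gen (t, i)))%:Z)) /=.
rewrite big_bool /= addrC /deg !(big_morph Posz PoszD (erefl 0%:Z)) -sumrN.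
congr (_ + _); apply: eq_bigr => i _; rewrite /eps /twisted /= ?ltn_ord ?mulN1r //.
by rewrite leqNgt ltn_ord mul1r.
Qed.

(* Chosen so that the degree in the variables of type [orientation k] is the
   larger one on B_k. *)
Definition orientation (k : int) : bool := (k <= 0).

Lemma grade_orientation (k : int) m : grade n n m = k <->
  deg (orientation k) m = (deg (~~ orientation k) m + `|k|)%N.
Proof.
rewrite grade_deg /orientation; case: (lerP k 0) => k0 /=; split; lia.
Qed.

Lemma Kcomp_B_part (k : int) s b g :
  Kcomp (orientation k) `|k|%N s b g -> B_part n n k g.
Proof.
move=> Kg; apply/B_partP => m mg; apply/grade_orientation.
by have [-> ->] := bideg_deg (Kcomp_bideg Kg) mg.
Qed.

Lemma B_part_Kcomp (k : int) f : B_part n n k f ->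
  lin_span (fun g => exists x : nat * nat,
    Kcomp (orientation k) `|k|%N x.1 x.2 g) f.
Proof.
set c := orientation k.
apply: (diag_ind (T := fun t => Fop t t) (phi := fun t m => (deg t m)%:R)).
- by move=> t g m; apply: mcoeff_Fdiag.
- exact: B_part_subspace.
- exact: lin_span_subspace.
- move=> t g /B_partP Bg; apply/B_partP => m.
  rewrite mcoeff_msupp mcoeff_Fdiag mulf_eq0 negb_or => /andP[_ gm].
  by apply: Bg; rewrite mcoeff_msupp.
move=> g /B_partP Bg g0 gT; have [m mg] := msupp_neq0 g0.
have /grade_orientation degm := Bg m mg.
have : bideg c (deg (~~ c) m + `|k|)%:R (deg (~~ c) m)%:R g.
  by split; rewrite (gT m) // degm.
move/(bideg_Kcomp charF); apply: lin_span_min; first exact: lin_span_subspace.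
by move=> h [s [b [_ Kh]]]; apply: lin_span_mem; exists (s, b).
Qed.

Lemma B_part_GK (k : int) :
  sp_irreducible n n (@B_part F n n n k) -> GK_type n n (@B_part F n n n k).
Proof.
move=> irr; apply: (@GK_of_Kcomp (orientation k) `|k|%N id) => //.
- by move=> s b g; apply: Kcomp_B_part.
- exact: B_part_Kcomp.
Qed.

Lemma sig_var t i : sig (var t i) = var (~~ t) i.
Proof. by rewrite /var reflectionX /sgn /= ltn_ord scale1r. Qed.

Lemma sig_Gop i j f : sig (Gop i j f) = Gop i j (sig f).
Proof.
rewrite /Gop !big_bool rmorphD !rmorphM /= !sig_var !reflection_deriv.
by rewrite /sgn /= ltn_ord !scale1r addrC.
Qed.

(** The minor is killed by the lowering operator, which therefore only differentiates the power of
    [var c i0], producing a falling factorial. *)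
Lemma lo_top_poly c b e s : (s <= e)%N ->
  iter s (Fop (~~ c) c) (top_poly c b e) =
  (e ^_ s)%:R *: (Delta c ^+ b * (var c i0 ^+ (e - s) * var (~~ c) i0 ^+ s)).
Proof.
have dl := d (~~ c) c.
have nc : (c == ~~ c) = false by case: (c).
have lo_exp f r : Fop (~~ c) c (f ^+ r) = r%:R *: (f ^+ r.-1 * Fop (~~ c) c f).
  elim: r => [|r IHr]; first by rewrite expr0 scale0r -mpolyC1 (derivationC dl).
  rewrite exprS dl.2 IHr -scalerAr mulrA -nat1r scalerDl scale1r [f ^+ r * _]mulrC.
  congr (_ + _); case: r {IHr} => [|r]; first by rewrite !scale0r.
  by rewrite -exprS [_ * f ^+ r.+1]mulrC.
have loDelta : Fop (~~ c) c (Delta c) = 0.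
  rewrite /Delta (derivationB dl) !dl.2 !FopX !eqxx nc !scale1r !scale0r.
  by rewrite !mulr0 !addr0 mulrC subrr.
have loY r : Fop (~~ c) c (var (~~ c) i0 ^+ r) = 0.
  by rewrite lo_exp FopX nc scale0r mulr0 scaler0.
elim: s => [|s IHs] se; first by rewrite expr0 mulr1 subn0 ffactn0 scale1r.
rewrite iterS IHs; last exact: ltnW.
rewrite (derivationZ dl) dl.2 lo_exp loDelta mulr0 scaler0 mul0r add0r.
rewrite dl.2 loY mulr0 addr0 lo_exp FopX eqxx scale1r -scalerAl -scalerAr scalerA.
rewrite -natrM ffactnSr subnS exprS; congr (_ *: (_ * _)).
by rewrite -mulrA.
Qed.

(** After s lowerings out of 2 s the two variables occur to the same power, and their product is
    invariant. Only the minor changes sign, b times. *)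
Lemma sig_top_poly c b s :
  sig (iter s (Fop (~~ c) c) (top_poly c b (2 * s))) =
  (-1) ^+ b *: iter s (Fop (~~ c) c) (top_poly c b (2 * s)).
Proof.
rewrite lo_top_poly; last by lia.
have sigD : sig (Delta c) = - Delta c.
  rewrite /Delta rmorphB !rmorphM /= !sig_var negbK opprB.
  by congr (_ - _); apply: mulrC.
rewrite reflectionZ !rmorphM !rmorphXn /= !sig_var negbK sigD.
have -> : (2 * s - s = s)%N by lia.
have swap (x y : V) : (- Delta c) ^+ b * (y * x) = (-1) ^+ b *: (Delta c ^+ b * (x * y)).
  rewrite [(- Delta c) ^+ b]exprNn -[in LHS]signr_odd -[in RHS]signr_odd.
  by case: (odd b); rewrite ?expr1 ?expr0 ?scaleN1r ?scale1r; ring.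
by rewrite swap !scalerA mulrC.
Qed.

(** The reflection commutes with gl_n, so the vectors with this sign form a submodule. It contains
    the explicit highest weight vector, hence is everything by irreducibility. *)
Lemma sig_Kcomp c s b g : Kcomp c 0 s b g -> sig g = (-1) ^+ b *: g.
Proof.
move=> [u]; rewrite addn0 => Ku ->.
pose U w := Khw c (b + 2 * s) b w /\
  sig (iter s (Fop (~~ c) c) w) = (-1) ^+ b *: iter s (Fop (~~ c) c) w.
suff : U u by case.
have sK := Khw_subspace F n c (b + 2 * s) b.
apply: (@Khw_irr F charF n n_gt1 c (b + 2 * s) b) (Ku).
- exact: leq_addr.
- split; first by split; [case: sK | rewrite iter_lo0 rmorph0 scaler0].
  move=> k f h [Kf sf] [Kh sh]; split; first exact: (proj2 sK).
  rewrite iter_lo_linear rmorphD /= reflectionZ sf sh scalerDr !scalerA.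
  by rewrite [k * _]mulrC.
- move=> i j f [Kf sf]; split; first exact: Khw_Gstable.
  by rewrite -iter_lo_Gop sig_Gop sf (derivationZ (Gop_der F i j)).
- by move=> f [].
- exists (top_poly c b (2 * s)); last exact: top_poly_neq0.
  by split; [apply: Khw_top_poly | apply: sig_top_poly].
Qed.

Lemma B0_half_GK (e : bool) :
  sp_irreducible n n (@B0_half F n n e) -> GK_type n n (@B0_half F n n e).
Proof.
(* [phi] enumerates the b of parity e, those whose components lie in the half of sign e. *)
move=> irr; pose phi b := (b.*2 + e)%N.
have odd_phi b : odd (phi b) = e by rewrite oddD odd_double oddb.
apply: (@GK_of_Kcomp (orientation 0) 0 phi) => //.
- by move=> x y /addIn/double_inj.
- move=> s b g Kg; split; first exact: (@Kcomp_B_part 0 s (phi b)).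
  by rewrite (sig_Kcomp Kg) -signr_odd odd_phi.
move=> f [Bf sf]; set S := lin_span _.
have sS : is_subspace S by apply: lin_span_subspace.
(* Twice the projection onto the half of sign e: it doubles f and kills the components of the other
   parity. *)
pose pr g := g + (-1) ^+ e *: sig g.
suff : S (pr f).
  rewrite /pr sf scalerA -signr_addb addbb scale1r -mulr2n -scaler_nat.
  by apply: subspaceZK => //; apply: two_neq0.
move: (B_part_Kcomp Bf); apply: (@lin_span_min _ _ _ (fun g => S (pr g))).
  have pr_lin r g h : pr (r *: g + h) = r *: pr g + pr h.
    rewrite /pr rmorphD /= reflectionZ !scalerDr !scalerA [_ * r]mulrC.
    by rewrite addrACA.
  split; first by rewrite /pr rmorph0 scaler0 addr0; case: sS.
  by move=> k g h Sg Sh; rewrite pr_lin; apply: (proj2 sS).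
move=> g [[s b] Kg]; rewrite /pr (sig_Kcomp Kg) scalerA.
have [be|be] := eqVneq (odd b) e; last first.
  rewrite -[(-1) ^+ b]signr_odd -signr_addb (_ : e (+) odd b) ?expr1.
    by rewrite scaleN1r subrr; case: sS.
  by move: be; case: (e); case: (odd b).
apply: (subspaceD sS); last apply: (subspaceZ _ sS);
  apply: lin_span_mem; exists (s, b./2); rewrite /phi /= addnC -be odd_double_half.
  exact: Kg.
exact: Kg.
Qed.

End KTypes.

(** * Irreducibility, highest-weight type and K-types combined *)

Theorem theorem4 (F : fieldType) (charF : [pchar F] =i pred0)
    (n n1 n2 : nat) (hn : (2 <= n)%N)
    (h1 : (1 <= n1)%N) (h12 : (n1 <= n2)%N) (h2 : (n2 <= n)%N) :
  (forall k : int, (n1 < n2)%N \/ k <> 0 ->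
     [/\ sp_irreducible n1 n2 (@B_part F n n1 n2 k),
         highest_weight_type n1 n2 (@B_part F n n1 n2 k) -> n2 = n
       & n1 = n -> n2 = n -> GK_type n1 n2 (@B_part F n n1 n2 k)]) /\
  (n1 = n2 ->
     exists W : bool -> {mpoly F[n + n]} -> Prop,
       is_direct_sum (@B_part F n n1 n2 0) W /\
       forall b : bool,
         [/\ sp_irreducible n1 n2 (W b),
             highest_weight_type n1 n2 (W b) -> n2 = n
           & n1 = n -> n2 = n -> GK_type n1 n2 (W b)]).
Proof.
have hw (W : {mpoly F[n + n]} -> Prop) : highest_weight_type n1 n2 W -> n2 = n.
  by apply: highest_weight_eq => //; apply: ltnW.
split=> [k cond|n12].
  have irr : sp_irreducible n1 n2 (@B_part F n n1 n2 k).
    have [lt12|ge12] := ltnP n1 n2; first exact: sp_irreducible_lt.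
    have n21 : n2 = n1 by apply/eqP; rewrite eqn_leq h12 ge12.
    rewrite n21; apply: sp_irreducible_eq => //; first by rewrite -n21.
    by case: cond => //; rewrite n21 ltnn.
  split=> [//||n1n n2n]; first exact: hw.
  by move: irr; rewrite n1n n2n; apply: B_part_GK.
move: hw h2; rewrite -n12 => hw n1n.
exists (@B0_half F n n1); split; first exact: B0_half_sum.
move=> b; have irr : sp_irreducible n1 n1 (@B0_half F n n1 b).
  by apply: B0_half_irr => //; apply: B0_half_neq0.
split=> [//||e1 _]; first exact: hw.
by move: irr; rewrite e1; apply: B0_half_GK.
Qed.
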